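(* Let $\pi=1\pi'\in S_n$, where $\pi'$ is a dominant permutation of $\{2,\ldots,n\}$. Then $$\mathfrak{G}^{\beta-1}_{\pi}(\mathbf{1})=\Big(\sum_{s\ge 0} i(\mathcal{P}(T(\pi)),s)\,\beta^s\Big)(1-\beta)^{\dim(\mathcal{P}(T(\pi)))+1},$$ where $\mathbf{1}=(1,\ldots,1)$ and $i(\mathcal{P},s)$ is the Ehrhart function of $\mathcal{P}$.
   Context: Permutations and diagrams. A permutation $\pi\in S_n$ is written in one-line notation $\pi_1\cdots\pi_n$. Positions in the $n\times n$ grid are (row, column), rows numbered top to bottom and columns left to right. The diagram of $\pi$ is $D(\pi)=\{(\pi_j,i): i<j,\ \pi_i>\pi_j\}$. $\pi=1\pi'$ with $\pi'$ dominant means $\pi_1=1$ and $\pi'=\pi_2\cdots\pi_n$ is a $132$-avoiding permutation of $\{2,\ldots,n\}$; equivalently $D(\pi)$ is the Young diagram of a partition whose north-west most box is at $(2,2)$. Pipe dreams. A pipe dream for $\pi$ is a tiling of the $n\times n$ grid by crosses (two strands cross straight) and elbows (one strand joins the left edge to the top edge, another joins the bottom edge to the right edge) such that all tiles at $(a,b)$ with $a+b\ge n+1$ are elbows, and if the strands entering from the left in rows $1,\ldots,n$ are labelled $1,\ldots,n$ and followed (ignoring second crossings among the same strands), they exit at the top reading $\pi_1,\ldots,\pi_n$ from left to right. It is reduced if no two strands cross twice. $PD(\pi)$ is the simplicial complex with vertices the entries $(a,b)$, $a+b\le n$, and facets the sets of elbow positions (in this triangle) of reduced pipe dreams for $\pi$.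 $\mathrm{Pipes}(\pi)$ is the set of all pipe dreams of $\pi$, reduced and nonreduced; for $P\in\mathrm{Pipes}(\pi)$, $F(P)$ is the (interior) face of $PD(\pi)$ given by the elbow positions of $P$. $\beta$-Grothendieck polynomial. $\mathfrak{G}^{\beta}_\pi(\mathbf{x})=\sum_{P\in\mathrm{Pipes}(\pi)}\beta^{\mathrm{codim}_{PD(\pi)}F(P)}\prod_{(i,j)\in\mathrm{cross}(P)}x_i$, where $\mathbf{x}=(x_1,\ldots,x_{n-1})$ and $\mathrm{cross}(P)$ is the set of positions (row $i$, column $j$) of the crosses of $P$. $\mathfrak{G}^{\beta-1}_\pi$ is obtained by replacing $\beta$ by $\beta-1$. The region $R(\pi)$. The bottom reduced pipe dream of $\pi$ has crosses at the boxes obtained by pushing $D(\pi)$ left (left-justifying each row); the top reduced pipe dream has crosses at the boxes obtained by pushing $D(\pi)$ up. The core region $\mathrm{cr}(\pi)$ is the union of the cross positions of these two pipe dreams, and $R(\pi)=\mathrm{cr}(\pi)\cup\{(1,1)\}$. The tree $T(\pi)$. Traverse the southeast boundary of $R(\pi)$ from its SW corner to its NE corner as a sequence of east steps (E) and north steps (N). Let $A$ consist of all N steps together with those E steps such that E bounds the bottom reduced pipe dream (the box of $R(\pi)$ directly above E is a cross of it) but the N step directly preceding E (if the preceding step is an N step) does not bound it (the box directly left of that N step is not a cross of it). Label the steps of $A$ by $1,\ldots,m$ in the order traversed; an E step not in $A$ receives the label of the N step directly preceding it. Place a dot in each box of $R(\pi)$ that is an elbow in the bottom reduced pipe dream, then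 let the dots in each column drop south so that they occupy the lowest boxes of that column of $R(\pi)$. $T(\pi)$ is the tree on $[m]$ with an edge $(i,j)$, $i<j$, whenever there is a dot in the box in the column of the E step labelled $i$ and the row of the N step labelled $j$. Root polytope and Ehrhart function. With $e_i$ the standard basis of $\mathbb{R}^m$, $\mathcal{P}(T(\pi))$ is the convex hull of $0$ and all $e_i-e_j$, $1\le i<j\le m$, lying in the cone of nonnegative combinations of the vectors $e_i-e_j$, $(i,j)\in E(T(\pi))$, $i<j$. For a polytope $\mathcal{P}\subset\mathbb{R}^m$ and an integer $s\ge 0$, $i(\mathcal{P},s)$ is the number of lattice points of the dilate $s\mathcal{P}$, i.e. $|s\mathcal{P}\cap\mathbb{Z}^m|$. *)

(* Defs.v *)
From HB Require Import structures.
From mathcomp Require Import all_boot all_order all_algebra fingroup perm finmap.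
From mathcomp Require Import boolp classical_sets cardinality reals.

Set Implicit Arguments.
Unset Strict Implicit.
Unset Printing Implicit Defensive.

Import Order.TTheory GRing.Theory Num.Theory.

(* Rows, columns, positions and values of permutations are numbered from 0:
   the box (a, b) : 'I_n * 'I_n lies in row a (from the top) and column b (from
   the left), and pi : 'S_n has one-line notation pi 0, pi 1, ..., pi (n-1). *)
Notation box n := ('I_n * 'I_n)%type.

(* pi = 1 pi' with pi' avoiding 132. *)
Definition one_dominant (n : nat) (pi : 'S_n.+1) : Prop :=
  pi ord0 = ord0 /\
  forall i j k : 'I_n.+1, (0 < i)%N -> (i < j)%N -> (j < k)%N ->
    ~ ((pi i < pi k)%N /\ (pi k < pi j)%N).

Section PipeDreams.
Variable n : nat.

(* The boxes with a + b <= n in 1-based numbering. *)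
Definition triangle : {set box n} := [set p : box n | (p.1 + p.2).+1 < n]%N.

(* The tiles are visited row by row from bottom to top, each row from left to
   right, so that a tile comes after its left and its lower neighbours.
   [west a] is the strand at the left edge of the next tile of row a, [south b]
   the strand at the lower edge of the next tile of column b, and [met] lists,
   with repetitions, the pairs of strands that went through a common cross. *)
Record sweep_state := SweepState {
  west : 'I_n -> nat;
  south : 'I_n -> nat;
  met : seq (nat * nat) }.

(* Strands entering from the left in row a are labelled a; those entering from
   below in column b get the label n + b, distinct from all of these. *)
Definition sweep_init : sweep_state :=
  SweepState (fun a => a) (fun b => n + b)%N [::].

(* P is the set of crosses. At a cross the strands go straight, unless they
   have crossed before: then the crossing is ignored and, as at an elbow, the
   strand from the left goes up and the one from below goes right. *)
Definition sweep_tile (P : {set box n}) (st : sweep_state) (t : box n) :=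
  let u := west st t.1 in
  let v := south st t.2 in
  let uv := (minn u v, maxn u v) in
  let met' := if t \in P then uv :: met st else met st in
  if (t \in P) && (uv \notin met st) then
    SweepState (west st) (south st) met'
  else
    SweepState [eta west st with t.1 |-> v] [eta south st with t.2 |-> u] met'.

Definition sweep (P : {set box n}) : sweep_state :=
  foldl (sweep_tile P) sweep_init
    [seq (a, b) | a <- rev (enum 'I_n), b <- enum 'I_n].

Definition exit_top (P : {set box n}) (b : 'I_n) : nat := south (sweep P) b.

Variable pi : 'S_n.

(* A pipe dream, reduced or not, is given by its set of crosses. *)
Definition Pipes : {set {set box n}} :=
  [set P : {set box n} | (P \subset triangle) && [forall b, exit_top P b == pi b]].

(* No two strands go twice through a common cross. Ignoring second crossings
   does not matter here, since the first repetition occurs before any crossing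
   has been ignored. *)
Definition reduced (P : {set box n}) : bool := uniq (met (sweep P)).

Definition elbows (P : {set box n}) : {set box n} := triangle :\: P.

(* The simplicial complex PD(pi), as the set of its faces. *)
Definition PD : {set {set box n}} :=
  [set F : {set box n} |
    [exists P in Pipes, reduced P && (F \subset elbows P)]].

(* dim PD(pi) - dim F; both dimensions are one less than the cardinalities. *)
Definition codim (F : {set box n}) : nat :=
  ((\max_(G in PD) #|G|) - #|F|)%N.

(* The polynomial as a function of beta and x over any commutative ring.  There
   is no cross in the last row, so the last entry of x does not occur. *)
Definition grothendieck (A : comNzRingType) (beta : A) (x : 'I_n -> A) : A :=
  (\sum_(P in Pipes) beta ^+ codim (elbows P) * \prod_(p in P) x p.1)%R.

End PipeDreams.

Section Tree.
Variables (n : nat) (pi : 'S_n).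

Definition diagram : {set box n} :=
  [set (pi j, i) | i in 'I_n, j in 'I_n & (i < j)%N && (pi j < pi i)%N].

(* Crosses of the bottom and of the top reduced pipe dream: the diagram pushed
   left, respectively up. *)
Definition bottom_dream : {set box n} :=
  [set p : box n | p.2 < #|[set q in diagram | q.1 == p.1]|]%N.
Definition top_dream : {set box n} :=
  [set p : box n | p.1 < #|[set q in diagram | q.2 == p.2]|]%N.

Definition core_region : {set box n} := bottom_dream :|: top_dream.

Definition region : {set box n} :=
  core_region :|: [set p : box n | (p.1 == 0 :> nat) && (p.2 == 0 :> nat)].

(* A step of the southeast boundary of the region is (true, p) for an N step
   along the right edge of the box p of the region, and (false, p) for an E step
   along the lower edge of the box p of the region. *)
Definition step := (bool * box n)%type.
Definition isN (s : step) : bool := s.1.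

Definition on_lower_edge (p : box n) : bool :=
  (p \in region) &&
  ~~ [exists q in region, (q.1 == p.1.+1 :> nat) && (q.2 == p.2)].
Definition on_right_edge (p : box n) : bool :=
  (p \in region) &&
  ~~ [exists q in region, (q.1 == p.1) && (q.2 == p.2.+1 :> nat)].

Definition boundary : seq step :=
  flatten [seq
    [seq (false, (r, c)) | c <- enum 'I_n & on_lower_edge (r, c)] ++
    [seq (true, (r, c)) | c <- enum 'I_n & on_right_edge (r, c)]
    | r <- rev (enum 'I_n)].

(* The box next to the step is a cross of the bottom reduced pipe dream. *)
Definition bounds (s : step) : bool := s.2 \in bottom_dream.

(* Membership in A of the step s, whose preceding step (if any) is prev. *)
Definition in_A (prev : option step) (s : step) : bool :=
  isN s ||
  bounds s && (if prev is Some s' then ~~ (isN s' && bounds s') else true).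

(* Labels of the steps ss that follow prev, when the labels 1, ..., k are
   already used. If the step preceding an E step outside A is an N step, then
   that N step has label k; otherwise the E step has no label, written 0. This
   only happens for the single E step of the boundary when pi is the identity. *)
Fixpoint labels_from (k : nat) (prev : option step) (ss : seq step) : seq nat :=
  if ss is s :: ss' then
    if in_A prev s then k.+1 :: labels_from k.+1 (Some s) ss'
    else (if prev is Some s' then (if isN s' then k else 0) else 0)
         :: labels_from k (Some s) ss'
  else [::].

Definition labels : seq nat := labels_from 0 None boundary.

Definition label (s : step) : nat := nth 0 labels (index s boundary).

(* The number m of vertices of the tree. *)
Definition tree_size : nat := \max_(l <- labels) l.

(* The dots after dropping: column c of the region has as many dots as it has
   elbows of the bottom reduced pipe dream, and they fill its lowest boxes. *)
Definition dots : {set box n} :=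
  [set p in region |
    #|[set q in region | (q.2 == p.2) && (p.1 < q.1)%N]| <
    #|[set q in region | (q.2 == p.2) && (q \notin bottom_dream)]|]%N.

(* The vertex i : 'I_tree_size stands for the label i.+1. *)
Definition tree : rel 'I_tree_size := fun i j =>
  (i < j)%N &&
  [exists p in dots,
    has (fun s => [&& ~~ isN s, s.2.2 == p.2 & label s == i.+1]) boundary &&
    has (fun s => [&& isN s, s.2.1 == p.1 & label s == j.+1]) boundary].

End Tree.
Arguments tree {n} pi _ _.

Section Polytopes.
Local Open Scope ring_scope.
Local Open Scope classical_set_scope.
Variables (R : realType) (m : nat).
Implicit Types (S P : set 'rV[R]_m) (e : rel 'I_m).

Definition convex_hull S : set 'rV[R]_m :=
  [set x | exists (k : nat) (p : 'I_k -> 'rV[R]_m) (w : 'I_k -> R),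
    [/\ forall i, S (p i), forall i, 0 <= w i, \sum_i w i = 1
      & x = \sum_i w i *: p i]].

(* e_i - e_j *)
Definition root_vector (i j : 'I_m) : 'rV[R]_m :=
  delta_mx ord0 i - delta_mx ord0 j.

Definition root_cone e : set 'rV[R]_m :=
  [set x | exists w : 'I_m -> 'I_m -> R,
    (forall i j, 0 <= w i j) /\
    x = \sum_(i < m) \sum_(j < m | (i < j)%N && e i j) w i j *: root_vector i j].

Definition root_polytope e : set 'rV[R]_m :=
  convex_hull ([set 0] `|`
    [set x | root_cone e x /\
             exists i j : 'I_m, (i < j)%N /\ x = root_vector i j]).

(* The largest k such that P contains k + 1 affinely independent points. *)
Definition affine_dim P : nat :=
  \max_(k < m.+1 | `[< exists (p0 : 'rV[R]_m) (p : k.-tuple 'rV[R]_m),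
      [/\ P p0, forall i, P (tnth p i) & free [seq q - p0 | q <- p]] >]) k.

(* The number of lattice points of the dilate s P; [fset_set] would return the
   empty set on an infinite set, but only bounded P are considered. *)
Definition ehrhart P (s : nat) : nat :=
  #|` fset_set [set z : 'rV[int]_m |
      [set s%:R *: x | x in P] (map_mx intr z)] |%fset.

End Polytopes.
Arguments root_polytope R {m} e _.

(* Coefficient of beta^k in the product of the formal power series
   \sum_s f s beta^s and \sum_s g s beta^s. *)
Definition series_mul (f g : nat -> int) (k : nat) : int :=
  (\sum_(s < k.+1) f s * g (k - s)%N)%R.

(* Main.v *)
(** Both sides are evaluated along the lattice path that bounds the partition
    of pi'.  The evaluation carries a natural number z: an E step increases z by
    one, and an N step either keeps z or replaces it by a smaller number, the
    latter with a factor beta.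

    Pipe dreams.  Pipes(pi) consists of the subwords of a word of simple
    transpositions whose product in the 0-Hecke monoid is pi.  Peeling off the
    first letter turns the sum with beta - 1 into a positive one: at each letter
    that is a descent one either swaps, with weight 1, or keeps the descent, with
    weight beta.  On Lehmer codes, one row of the grid is one pass of bubble sort.
    An entry loses at most one per pass and all of them must vanish at the end,
    which leaves just one free choice per row, that of the new z.

    Root polytope.  The cone of T(pi) is cut out by the signs of the coordinates
    at the pure E and pure N labels and by the positivity of partial sums, and the
    lattice points of the s-th dilate are those whose positive part sums to at
    most s.  They are thus lattice paths staying nonnegative.  Let U and D denote
    the operators of an arbitrary increase, with weight beta per unit, and of an
    arbitrary decrease; then (1 - beta) U D = U + D - 1, which describes the corner
    labels, and normalizing by powers of 1 - beta gives the same transfer. *)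

Require Import Defs.
From mathcomp Require Import boolp classical_sets cardinality.
From mathcomp Require Import ring zify lra.
From mathcomp Require Import all_boot all_order all_algebra fingroup perm finmap.
From mathcomp Require Import reals.

Import GRing.Theory.
Local Open Scope ring_scope.

Set Implicit Arguments.
Unset Strict Implicit.
Unset Printing Implicit Defensive.
Import Order.TTheory Num.Theory.

(** * Passes over one row *)

(** No bijection between pipe dreams and lattice points is built; the carried number z has a
    different meaning on each side. On the pipe dream side it is the number of entries that the next
    pass may lower or keep. On the polytope side it is z + 1 operators U standing, at height 0, in
    front of the labels still to be read. Moving a D to the left through these U by (1 - beta) U D =
    U + D - 1 leaves terms with fewer U, and these are the replacements of z by smaller numbers. The
    extra U is the first label, a pure E label unless pi is the identity, and every label accounts
    for one factor 1 - beta, which gives the exponent dim + 1.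

    Two facts about T(pi) determine the cone: an edge goes from an E label to an N label, and every
    e_i - e_j with i < j, i an E label and j an N label, lies in the cone. The latter is proved by
    cutting the interval from i to j at its corner labels, those of both an E and an N step. The
    identity has a single label and is treated apart. *)

Section Passes.
Variables (A : comNzRingType) (b : A).

(* [g] is the code entry that the strand entering the row carries past the
   entries [s]; [K] values the row left behind.  Where a crossing is due, either
   it is made (weight 1) or it is postponed (weight [b]). *)
Fixpoint pass (K : seq nat -> A) (g : nat) (s : seq nat) : A :=
  if s is e :: s' then
    if (g < e)%N then
      b * pass (fun l => K (g :: l)) e s' + pass (fun l => K (e.-1 :: l)) g s'
    else pass (fun l => K (g :: l)) e s'
  else K [:: g].

(* The rows still to be traversed carry the entries of [pre], last row first. *)
Fixpoint passes (pre s : seq nat) : A :=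
  if pre is g :: pre' then pass (passes pre') g s else (all (pred1 0%N) s)%:R.

Lemma pass_zero K g s : (forall l, K l = 0) -> pass K g s = 0.
Proof.
elim: s K g => [|e s IH] K g K0 /=; first exact: K0.
by case: ifP => _; rewrite !IH ?mulr0 ?addr0 // => l; exact: K0.
Qed.

(* A pass lowers each entry by at most one. *)
Lemma pass0 p K g s :
    (forall l, has (ltn p) l -> K l = 0) -> has (ltn p.+1) s || (p < g)%N ->
  pass K g s = 0.
Proof.
elim: s K g => [|e s IHs] K g K0 /=.
  by move=> gp; apply: K0 => /=; rewrite orbF.
move=> H.
have K0' x l : has (ltn p) l -> K (x :: l) = 0 by move=> hl; apply: K0 => /=; rewrite hl orbT.
have Kbig x l : (p < x)%N -> K (x :: l) = 0 by move=> px; apply: K0 => /=; rewrite px.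
have pass_big x g' s' : (p < x)%N -> pass (fun l => K (x :: l)) g' s' = 0.
  by move=> px; apply: pass_zero => l; apply: Kbig.
case: ifP => [lt_ge|/negbT]; last first.
  rewrite -leqNgt => le_eg.
  have [pg|gp] := ltnP p g; first exact: pass_big.
  apply: IHs (K0' g) _.
  by move: H; rewrite -orbA => /or3P[|->//|]; lia.
have [pg|gp] := ltnP p g.
  rewrite pass_big // mulr0 add0r.
  by apply: IHs (K0' _) _; rewrite pg orbT.
have [pe|ep] := ltnP p.+1 e.
  rewrite (pass_big e.-1) ?addr0; last by lia.
  by rewrite (IHs _ _ (K0' g)) ?mulr0 //; apply/orP; right; lia.
move: H; rewrite -orbA => /or3P[|hs|]; [lia| |lia].
by rewrite !(IHs _ _ (K0' _)) ?mulr0 ?addr0 // hs.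
Qed.

Lemma passes0 pre s : has (ltn (size pre)) s -> passes pre s = 0.
Proof.
elim: pre s => [|g pre IH] s hs /=.
  by case: allP => // s0; case/hasP: hs => x /s0 /= /eqP->.
by apply: (@pass0 (size pre)) => //; rewrite hs.
Qed.

(* In the next three lemmas, [a] is the number of passes that follow this one, so
   that an entry [a.+1] must be lowered now and an entry [a] may be. *)
Lemma pass_small a K c S r s :
    (forall l, has (ltn a) l -> K l = 0) ->
    (forall l, all (geq a) l -> [seq x <- l | (x < a)%N] = c :: S -> K l = r) ->
    (c < a)%N -> path geq c S -> all (geq a.+1) s ->
    [seq x <- s | (x <= a)%N] = S ->
  pass K c s = r.
Proof.
elim: s K c S => [|e s IHs] K c S K0 Kr lt_ca sS.
  by move=> _ S0; apply: Kr; rewrite /= ?andbT ?lt_ca -?S0 //; apply: ltnW.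
have K0' x l : has (ltn a) l -> K (x :: l) = 0 by move=> hl; apply: K0 => /=; rewrite hl orbT.
move=> /= /andP[le_ea les].
case: (leqP e a) => [le_ea' /= S_def|lt_ae /= S_def].
  case: S S_def sS Kr => // d S [-> s_def] /andP[le_dc sS] Kr.
  rewrite ltnNge [(d <= c)%N]le_dc /=.
  apply: (IHs _ _ S) => // [|l al fl|].
  - exact: K0'.
  - by apply: Kr; rewrite /= ?lt_ca ?fl // al andbT; apply: ltnW.
  by apply: leq_ltn_trans lt_ca.
have -> : e = a.+1 by apply/eqP; rewrite eqn_leq lt_ae andbT.
rewrite leqW //= (@pass0 a _ a.+1) ?ltnSn ?orbT // ?mulr0 ?add0r; last exact: K0'.
apply: (IHs _ _ S) => // [l hl|l al fl]; first exact: K0'.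
by apply: Kr => /=; rewrite ?leqnn ?ltnn.
Qed.

Lemma pass_top a K S r s :
    (forall l, has (ltn a) l -> K l = 0) ->
    (forall l, all (geq a) l -> [seq x <- l | (x < a)%N] = S -> K l = r) ->
    sorted geq S -> all (gtn a) S -> all (geq a.+1) s ->
    (exists z, [seq x <- s | (x <= a)%N] = nseq z a ++ S) ->
  pass K a s = r.
Proof.
elim: s K => [|e s IHs] K K0 Kr sS aS.
  by move=> _ [z /=]; case: z => //= S0; apply: Kr; rewrite /= ?leqnn ?ltnn.
have K0' x l : has (ltn a) l -> K (x :: l) = 0 by move=> hl; apply: K0 => /=; rewrite hl orbT.
have Kr' l : all (geq a) l -> [seq x <- l | (x < a)%N] = S -> K (a :: l) = r.
  by move=> al fl; apply: Kr => /=; rewrite ?leqnn ?ltnn.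
move=> /= /andP[le_ea les] [z].
case: (leqP e a) => [le_ea' /= S_def|lt_ae /= S_def].
  case: z S_def => [|z] /=; last first.
    by move=> [-> s_def]; apply: IHs => //; [exact: K0'|exists z].
  case: S {IHs} sS aS Kr Kr' => // d S sS aS Kr Kr' [e_d s_def]; subst d.
  case/andP: aS => lt_ea aS.
  apply: (pass_small (a := a) (S := S)) => //; exact: K0'.
have -> : e = a.+1 by apply/eqP; rewrite eqn_leq lt_ae andbT.
rewrite (@pass0 a _ a.+1) ?ltnSn ?orbT // ?mulr0 ?add0r; last exact: K0'.
by apply: IHs => //; [exact: K0'|exists z].
Qed.

(** The strand [g] meets the [z] copies of [a] one after the other. Swapping lowers a copy to [a.-1]
    and carries [g] on; keeping the descent deposits [g] and carries an [a], after which the pass is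
    forced by [pass_top]. Keeping at the copy number [z'.+1] gives [b * f z'], and swapping at all
    copies gives [f z]. *)
Lemma pass_step a K g S f z s :
    (forall l, has (ltn a) l -> K l = 0) ->
    (forall l z', all (geq a) l ->
       [seq x <- l | (x < a)%N] = nseq z' a.-1 ++ g :: S -> K l = f z') ->
    (g < a)%N -> path geq g S -> all (gtn a) S -> all (geq a.+1) s ->
    [seq x <- s | (x <= a)%N] = nseq z a ++ S ->
  pass K g s = f z + b * \sum_(z' < z) f z'.
Proof.
elim: s K f z => [|e s IHs] K f z K0 Kf lt_ga sS aS.
  case: z => //= _ S0; rewrite big_ord0 mulr0 addr0.
  by apply: (Kf _ 0%N) => /=; rewrite ?lt_ga -?S0 // andbT; apply: ltnW.
have K0' x l : has (ltn a) l -> K (x :: l) = 0 by move=> hl; apply: K0 => /=; rewrite hl orbT.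
move=> les; case: z => [|z] s_def.
  rewrite big_ord0 mulr0 addr0.
  by apply: (pass_small (a := a) (S := S)) => // l al fl; apply: (Kf _ 0%N).
move: les s_def => /= /andP[le_ea les].
case: (leqP e a) => [_ [-> s_def]|lt_ae /= s_def].
  rewrite lt_ga (@pass_top a _ S (f 0%N)) //; first last.
  - by exists z.
  - exact: path_sorted sS.
  - move=> l al fl; apply: (Kf _ 0%N) => /=; last by rewrite lt_ga fl.
    by rewrite al andbT; apply: ltnW.
  - exact: K0'.
  rewrite (IHs _ (fun z' => f z'.+1) z) //; first last.
  - move=> l z' al fl; apply: Kf => /=; first by rewrite al andbT leq_pred.
    by rewrite fl; case: (a) lt_ga => //= a' _; rewrite ltnSn.
  - exact: K0'.
  by rewrite big_ord_recl mulrDr; ring.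
have -> : e = a.+1 by apply/eqP; rewrite eqn_leq lt_ae andbT.
rewrite leqW //= (@pass0 a _ a.+1) ?ltnSn ?orbT // ?mulr0 ?add0r; last exact: K0'.
apply: IHs => // [l hl|l z' al fl]; first exact: K0'.
by apply: Kf => /=; rewrite ?leqnn ?ltnn.
Qed.

(* The common value of both sides of the theorem, as a transfer along a word.
   A letter [(e, d)] allows an increase if [e] and a
   decrease if [d]. *)
Fixpoint word_poly (w : seq (bool * bool)) (z : nat) : A :=
  if w is (e, d) :: w' then
    word_poly w' (e + z) + (if d then b * \sum_(y < e + z) word_poly w' y else 0)
  else 1.

Lemma word_poly_up k w z :
  word_poly (nseq k (true, false) ++ w) z = word_poly w (k + z).
Proof. by elim: k z => //= k IH z; rewrite addr0 IH addnS. Qed.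

Lemma sorted_top c l : sorted geq l -> all (geq c) l ->
  l = nseq (count_mem c l) c ++ [seq x <- l | (x < c)%N].
Proof.
elim: l => //= x l IH xl /andP[le_xc lc].
have := IH (path_sorted xl) lc.
move: le_xc; rewrite leq_eqVlt => /orP[/eqP-> {1}->|lt_xc _]; first by rewrite eqxx ltnn.
rewrite lt_xc ltn_eqF //=.
have /allP lx : all (geq x) l by apply: order_path_min xl => u v w /= h1 h2; apply: leq_trans h2 h1.
have -> : count_mem c l = 0%N.
  by apply/count_memPn; apply/negP => /lx /=; rewrite leqNgt lt_xc.
congr cons; apply/esym/all_filterP/allP => y /lx /= le_yx.
exact: leq_ltn_trans lt_xc.
Qed.

(* [e] is the Lehmer code of the inverse of [1 pi'].  Before the pass of row [a],
   the only freedom left in the rows below is the number [z] of entries equal to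
   [a]. *)
Section Code.
Variables (N : nat) (e : nat -> nat).
Hypotheses (e_lt : forall a, (0 < a < N)%N -> (e a < a)%N).
Hypotheses (e_dom : forall a j, (0 < a)%N -> (a < j < N)%N ->
  (e j <= e a)%N || (a <= e j)%N).

Definition code_mult a := count_mem a (map e (iota a.+1 (N - a.+1))).

Fixpoint code_word a : seq (bool * bool) :=
  if a is a'.+1 then
    (false, true) :: nseq (code_mult a') (true, false) ++ code_word a'
  else [::].

(** By [e_dom], an entry that exceeds an earlier one is at least the index of that earlier one,
    hence at least [a] here, and the filter drops it. *)
Lemma sorted_code a k : (0 < a)%N -> (a <= N - k)%N ->
  sorted geq [seq x <- map e (iota (N - k) k) | (x < a)%N].
Proof.
move=> a0; elim: k => // k IH le_ak /=.
have -> : (N - k.+1).+1 = (N - k)%N by lia.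
have {}IH := IH ltac:(lia).
case: ifP => //= lt_ea; rewrite path_min_sorted //.
apply/allP => x; rewrite mem_filter => /andP[lt_xa /mapP[j]].
rewrite mem_iota => jr x_def; rewrite x_def /=.
have /orP[//|] := @e_dom (N - k.+1) j ltac:(lia) ltac:(lia).
by rewrite -x_def; lia.
Qed.

Lemma passes_word a s z : e 0 = 0%N -> (a < N)%N -> all (geq a.+1) s ->
    [seq x <- s | (x <= a)%N] =
      nseq z a ++ [seq x <- map e (iota a.+1 (N - a.+1)) | (x < a)%N] ->
  passes (rev (map e (iota 0 a.+1))) s = word_poly (code_word a) z.
Proof.
move=> e0; elim: a s z => [|a IH] s z lt_aN les.
  have F0 (l : seq nat) : [seq x <- l | (x < 0)%N] = [::] by elim: l.
  rewrite F0 cats0 /= => s_def; rewrite e0.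
  apply: (@pass_top 0 _ [::]) => //.
  - by move=> l hl; case: allP => // l0; case/hasP: hl => x /l0 /= /eqP->.
  - move=> l l0 _; case: allP => // -[] x xl; move/allP: l0 => /(_ x xl) /=.
    by rewrite leqn0.
  - by exists z; rewrite cats0.
move=> s_def; rewrite -addn1 iotaD map_cat rev_cat add0n /=.
pose S := [seq x <- map e (iota a.+2 (N - a.+2)) | (x < a.+1)%N].
have N_def : (N - a.+1 = (N - a.+2).+1)%N by lia.
have lt_e : (e a.+1 < a.+1)%N by apply: e_lt.
have gS : e a.+1 :: S = [seq x <- map e (iota a.+1 (N - a.+1)) | (x < a.+1)%N].
  by rewrite N_def /= lt_e.
have sgS : sorted geq (e a.+1 :: S).
  rewrite gS; have := @sorted_code a.+1 (N - a.+1) isT ltac:(lia).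
  by have -> : (N - (N - a.+1) = a.+1)%N by lia.
have agS : all (geq a) (e a.+1 :: S).
  by rewrite gS; apply/allP => x; rewrite mem_filter => /andP[].
(* The sorted entries at most [a] begin with the copies of [a]. They join the [z'] entries just
   lowered to [a], which explains the [code_mult a] increases in the word. *)
have gS_def : e a.+1 :: S = nseq (code_mult a) a ++
    [seq x <- map e (iota a.+1 (N - a.+1)) | (x < a)%N].
  rewrite [LHS](sorted_top sgS agS) gS; congr (nseq _ _ ++ _).
    by rewrite count_filter; apply: eq_count => x /=; case: eqP => //= ->; rewrite ltnSn.
  by rewrite -filter_predI; apply: eq_filter => x /=; lia.
rewrite (@pass_step a.+1 _ (e a.+1) S
  (fun z' => word_poly (nseq (code_mult a) (true, false) ++ code_word a) z') z) //.
- by move=> l hl; apply: passes0; rewrite size_rev /= size_map size_iota.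
- move=> l z' al fl; rewrite word_poly_up; apply: IH => //; first by lia.
  by rewrite addnC nseqD -catA -gS_def -fl.
- by case/andP: agS.
Qed.
End Code.
End Passes.

(** * Lehmer codes and the 0-Hecke action *)

Section Bubble.
Variables (A : comNzRingType) (b : A).

(** Effect on a Lehmer code of removing the descent at [i], where entry [j] counts the larger values
    to the left of place [j]: the smaller value moves left and loses one inversion. *)
Definition code_swap i (c : seq nat) :=
  take i c ++ [:: (nth 0 c i.+1).-1, nth 0 c i & drop i.+2 c]%N.

(* [bubble w c] sums over the ways to sort the permutation of code [c] by the
   letters [w], where a descent may be kept at the cost of a factor [b]. *)
Fixpoint bubble (w c : seq nat) : A :=
  if w is i :: w' then
    if (nth 0 c i < nth 0 c i.+1)%N then b * bubble w' c + bubble w' (code_swap i c)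
    else bubble w' c
  else (all (pred1 0%N) c)%:R.

Lemma eq_pass K K' g s :
    (forall l, size l = (size s).+1 -> K l = K' l) ->
  pass b K g s = pass b K' g s.
Proof.
elim: s K K' g => [|e s IHs] K K' g KK' /=; first exact: KK'.
by case: ifP => _; do ?[congr (_ * _ + _)]; apply: IHs => l sl; apply: KK'; rewrite /= sl.
Qed.

Lemma bubble_pass w p g s :
  bubble (iota (size p) (size s) ++ w) (p ++ g :: s) =
  pass b (fun l => bubble w (p ++ l)) g s.
Proof.
elim: s p g => [//|e s IHs] p g /=.
rewrite /code_swap !nth_cat ltnn subnn take_size_cat //.
have -> : ((size p).+1 < size p)%N = false by lia.
rewrite subSnn /=.
rewrite drop_cat; have -> : ((size p).+2 < size p)%N = false by lia.
have -> : ((size p).+2 - size p = 2)%N by lia.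
have IH x y : bubble (iota (size p).+1 (size s) ++ w) (p ++ x :: y :: s) =
    pass b (fun l => bubble w (p ++ x :: l)) y s.
  have := IHs (rcons p x) y; rewrite size_rcons cat_rcons => ->.
  by apply: eq_pass => l _; rewrite cat_rcons.
by rewrite /= drop0 !IH.
Qed.

Lemma bubble_rows N p s : (size p + size s)%N = N ->
  bubble (flatten [seq iota a (N.-1 - a) | a <- rev (iota 0 (size p))]) (p ++ s) =
  passes b (rev p) s.
Proof.
elim/last_ind: p s => [//|p g IHp] s.
rewrite size_rcons -addn1 iotaD rev_cat add0n /= => sz.
have -> : (N.-1 - size p = size s)%N by lia.
rewrite cat_rcons bubble_pass rev_rcons /=; apply: eq_pass => l sl.
by apply: IHp; rewrite sl; lia.
Qed.

(** Subwords are chosen by positions, so equal words occur with multiplicity, as they do for sets of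
    crosses. *)
Fixpoint sub_sum (w : seq nat) (F : seq nat -> A) : A :=
  if w is i :: w' then sub_sum w' F + sub_sum w' (fun u => F (i :: u)) else F [::].

Lemma sub_sum_cons i w F : sub_sum (i :: w) F = sub_sum w F + sub_sum w (fun u => F (i :: u)).
Proof. by []. Qed.

Lemma bubble_cons i w c : bubble (i :: w) c =
  if (nth 0 c i < nth 0 c i.+1)%N then b * bubble w c + bubble w (code_swap i c)
  else bubble w c.
Proof. by []. Qed.

Lemma eq_sub_sum w F G : (forall u, {subset u <= w} -> F u = G u) -> sub_sum w F = sub_sum w G.
Proof.
elim: w F G => [|i w IH] F G FG /=; first exact: FG.
congr (_ + _); apply: IH => u uw; apply: FG => x; rewrite !inE.
  by move/uw->; rewrite orbT.
by case/orP => [->//|/uw->]; rewrite orbT.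
Qed.

Lemma sub_sumD w F G : sub_sum w (fun u => F u + G u) = sub_sum w F + sub_sum w G.
Proof. by elim: w F G => //= i w IH F G; rewrite !IH; ring. Qed.

Lemma sub_sumZ a w F : sub_sum w (fun u => a * F u) = a * sub_sum w F.
Proof. by elim: w F => //= i w IH F; rewrite !IH mulrDr. Qed.

Lemma sub_sum0 w : sub_sum w (fun=> 0) = 0.
Proof. by elim: w => //= i w ->; rewrite addr0. Qed.
End Bubble.

Lemma card_ord_count m (P : pred nat) : #|[set k : 'I_m | P k]| = count P (iota 0 m).
Proof.
rewrite -sum1dep_card -sum1_count; have := @big_mkord _ 0 addn m P (fun=> 1).
by rewrite /index_iota subn0.
Qed.

Lemma card_ord_lt n (k : nat) : (k <= n.+1)%N -> #|[set l : 'I_n.+1 | (l < k)%N]| = k.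
Proof.
move=> le_kn.
have -> : #|[set l : 'I_n.+1 | (l < k)%N]| = count (fun l => (l < k)%N) (iota 0 n.+1) :=
  card_ord_count _ _.
have -> : n.+1 = (k + (n.+1 - k))%N by rewrite subnKC.
rewrite iotaD count_cat -[RHS]addn0 -[in RHS](size_iota 0 k); congr addn.
  by apply/eqP; rewrite -all_count; apply/allP => x; rewrite mem_iota.
apply/eqP; rewrite -leqn0 leqNgt -has_count; apply/hasPn => x.
by rewrite mem_iota -leqNgt => /andP[].
Qed.

Section Hecke.
Variable n : nat.
Implicit Types (s t q : 'S_n.+1) (i j : nat).
Local Open Scope nat_scope.
Local Open Scope group_scope.

Definition adj i : 'S_n.+1 := tperm (inord i) (inord i.+1).

Lemma adjL i : adj i (inord i) = inord i.+1. Proof. exact: tpermL. Qed.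
Lemma adjR i : adj i (inord i.+1) = inord i. Proof. exact: tpermR. Qed.
Lemma adjK i : adj i * adj i = 1. Proof. exact: tperm2. Qed.

Lemma adj_val i (k : 'I_n.+1) : (i < n)%N ->
  adj i k = (if (k : nat) == i then i.+1 else if (k : nat) == i.+1 then i else k) :> nat.
Proof.
move=> lt_in; have hi : @inord n i = i :> nat by rewrite inordK //; lia.
have hi1 : @inord n i.+1 = i.+1 :> nat by rewrite inordK //; lia.
rewrite /adj; case: tpermP => [->|->|].
- by rewrite hi hi1 eqxx.
- by rewrite hi1 hi eqxx; case: eqP => //; lia.
by move=> /eqP n1 /eqP n2; move: n1 n2; rewrite -!val_eqE /= hi hi1 => /negPf-> /negPf->.
Qed.

Definition hecke i s : 'S_n.+1 := if s (inord i) < s (inord i.+1) then adj i * s else s.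
Definition hecke_left i s : 'S_n.+1 :=
  if s^-1 (inord i) < s^-1 (inord i.+1) then s * adj i else s.

Lemma adj_lt i (k l : 'I_n.+1) : (i < n)%N ->
  ~~ ((k == i :> nat) && (l == i.+1 :> nat)) -> ~~ ((k == i.+1 :> nat) && (l == i :> nat)) ->
  (adj i k < adj i l) = (k < l).
Proof. by move=> lt_in; rewrite !adj_val //; do ?case: ifP; lia. Qed.

(* Left and right actions of the 0-Hecke monoid. *)
Lemma hecke_comm i j s : (i < n)%N -> (j < n)%N ->
  hecke i (hecke_left j s) = hecke_left j (hecke i s).
Proof.
move=> lt_in lt_jn.
have hj : @inord n j = j :> nat by rewrite inordK //; lia.
have hj1 : @inord n j.+1 = j.+1 :> nat by rewrite inordK //; lia.
have hi : @inord n i = i :> nat by rewrite inordK //; lia.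
have hi1 : @inord n i.+1 = i.+1 :> nat by rewrite inordK //; lia.
have inv1 k l : s k = l -> s^-1 l = k by move=> <-; rewrite permK.
have inv2 k l : s^-1 l = k -> s k = l by move=> <-; rewrite permKV.
have nlt k : (k.+1 < k) = false by lia.
(* The two actions interfere only if the places [i], [i.+1] carry the values [j], [j.+1]. In
   increasing order both actions are the same swap, and whichever comes second does nothing; in
   decreasing order neither does anything. Otherwise neither action affects the comparison made by
   the other. *)
have [/andP[/eqP p1 /eqP p2]|p3] :=
    boolP ((s (inord i) == inord j) && (s (inord i.+1) == inord j.+1)).
  have sE : adj i * s = s * adj j.
    by rewrite /adj -p1 -p2 -tpermJ; apply: conjgC.
  rewrite /hecke_left /hecke (inv1 _ _ p1) (inv1 _ _ p2) p1 p2 !hi !hi1 !hj !hj1 !ltnSn.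
  rewrite sE !permM p1 p2 adjL adjR hj hj1 nlt /=.
  rewrite -sE invMg !permM (inv1 _ _ p1) (inv1 _ _ p2).
  by rewrite /adj tpermV tpermL tpermR hi hi1 nlt.
have [/andP[/eqP p1 /eqP p2]|p4] :=
    boolP ((s (inord i) == inord j.+1) && (s (inord i.+1) == inord j)).
  rewrite /hecke_left /hecke (inv1 _ _ p1) (inv1 _ _ p2) !hi !hi1.
  by rewrite p1 p2 !hj !hj1 !nlt /= ?p1 ?p2 ?(inv1 _ _ p1) ?(inv1 _ _ p2) ?hi ?hi1 ?hj ?hj1 ?nlt.
have q3 : ~~ ((s^-1 (inord j) == inord i) && (s^-1 (inord j.+1) == inord i.+1)).
  by apply: contra p3 => /andP[/eqP/inv2-> /eqP/inv2->]; rewrite !eqxx.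
have q4 : ~~ ((s^-1 (inord j) == inord i.+1) && (s^-1 (inord j.+1) == inord i)).
  by apply: contra p4 => /andP[/eqP/inv2-> /eqP/inv2->]; rewrite !eqxx.
have cR : (adj j (s (inord i)) < adj j (s (inord i.+1))) = (s (inord i) < s (inord i.+1)).
  by apply: adj_lt => //; move: p3 p4; rewrite -!val_eqE /= hj hj1.
have cL : (adj i (s^-1 (inord j)) < adj i (s^-1 (inord j.+1))) =
    (s^-1 (inord j) < s^-1 (inord j.+1)).
  by apply: adj_lt => //; move: q3 q4; rewrite -!val_eqE /= hi hi1.
rewrite /hecke_left /hecke.
have adjV : (adj i)^-1 = adj i by rewrite tpermV.
case cl: (s^-1 (inord j) < s^-1 (inord j.+1)); case cr: (s (inord i) < s (inord i.+1)).
all: by rewrite ?invMg ?adjV ?permM ?cR ?cL ?cr ?cl ?mulgA.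
Qed.

Definition ecode q j := #|[set k : 'I_n.+1 | (k < j) && (q (inord j) < q k)]|.
Definition code q : seq nat := [seq ecode q j | j <- iota 0 n.+1].
Arguments code : simpl never.

Lemma nth_code q j : j <= n -> nth 0 (code q) j = ecode q j.
Proof. by move=> lt_jn; rewrite (nth_map 0) ?size_iota // nth_iota. Qed.

Lemma ecode_descent q i : i < n ->
  (ecode q i < ecode q i.+1) = (q (inord i.+1) < q (inord i)).
Proof.
move=> lt_in.
have hi : @inord n i = i :> nat by rewrite inordK //; lia.
have hi1 : @inord n i.+1 = i.+1 :> nat by rewrite inordK //; lia.
rewrite /ecode; case: (ltnP (q (inord i.+1))) => [lt_q|le_q].
  apply: proper_card; apply/properP; split.
    apply/fintype.subsetP => k; rewrite !inE => /andP[lt_ki lt_qk].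
    by rewrite (leqW lt_ki) (ltn_trans lt_q).
  by exists (inord i); rewrite !inE hi ?ltnn ?ltnSn.
apply/negbTE; rewrite -leqNgt; apply/subset_leq_card/fintype.subsetP => k.
rewrite !inE ltnS leq_eqVlt => /andP[/orP[/eqP k_i|->] lt_qk]; last exact: leq_ltn_trans lt_qk.
have k_def : k = inord i by apply: val_inj; rewrite /= hi.
by move: lt_qk; rewrite k_def ltnNge le_q.
Qed.

Lemma code_adj q i : i < n -> q (inord i.+1) < q (inord i) ->
  code (adj i * q) = code_swap i (code q).
Proof.
move=> lt_in lt_q.
have hi : @inord n i = i :> nat by rewrite inordK //; lia.
have hi1 : @inord n i.+1 = i.+1 :> nat by rewrite inordK //; lia.
have sz : size (code q) = n.+1 by rewrite size_map size_iota.
have qi : (adj i * q) (inord i) = q (inord i.+1) by rewrite permM adjL.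
have qi1 : (adj i * q) (inord i.+1) = q (inord i) by rewrite permM adjR.
have adj_small k : k < i -> adj i (inord k) = inord k.
  move=> lt_ki; apply: val_inj; rewrite /= adj_val // inordK; last by lia.
  by do ?case: ifP; lia.
have small (k : 'I_n.+1) : k < i -> (adj i * q) k = q k.
  by move=> lt_ki; rewrite permM -[k in LHS]inord_val adj_small // inord_val.
apply: (@eq_from_nth _ 0).
  by rewrite !size_map size_cat /= size_take size_drop sz !size_map !size_iota; case: ifP; lia.
rewrite size_map size_iota => j lt_jn.
have le_in := ltnW lt_in.
rewrite /code_swap !nth_code // nth_cat size_take sz.
have -> : i < n.+1 by lia.
have gen : j <> i -> j <> i.+1 -> ecode (adj i * q) j = ecode q j.
  move=> ji ji1; rewrite /ecode -[RHS](card_imset _ (@perm_inj _ (adj i))).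
  apply: eq_card => k; rewrite !inE; apply/idP/imsetP => [/andP[lt_kj lt_qk]|[l]].
    exists (adj i k); last by rewrite -permM adjK perm1.
    rewrite inE; move: lt_qk; rewrite !permM.
    have -> : adj i (inord j) = inord j.
      by apply: val_inj; rewrite /= adj_val // inordK //; do ?case: ifP; lia.
    by move->; rewrite adj_val // andbT; do ?case: ifP; lia.
  rewrite inE => /andP[lt_lj lt_ql] ->; rewrite !permM tpermK.
  have -> : adj i (inord j) = inord j.
    by apply: val_inj; rewrite /= adj_val // inordK //; do ?case: ifP; lia.
  by rewrite lt_ql adj_val // andbT; do ?case: ifP; lia.
case: ltnP => [lt_ji|le_ij]; first by rewrite nth_take // nth_code //; apply: gen; lia.
case j_i : (j - i) => [|[|d]] /=.
- have -> : j = i by lia.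
  rewrite /ecode qi [in RHS](cardsD1 (inord i)) inE hi ltnSn lt_q add1n /=.
  apply: eq_card => k; rewrite !inE -val_eqE /= hi ltnS ltn_neqAle andbA.
  case: (ltngtP k i) => //= lt_ki.
  by rewrite small.
- have -> : j = i.+1 by lia.
  rewrite /ecode qi1; apply: eq_card => k; rewrite !inE ltnS leq_eqVlt.
  case: eqP => [k_i|_] /=.
    have -> : k = inord i by apply: val_inj; rewrite /= hi.
    by rewrite qi hi ltnn ltnNge ltnW.
  by case: ltnP => //= lt_ki; rewrite small.
rewrite nth_drop -[RHS]/(nth 0 (code q) (i.+2 + d)); have -> : i.+2 + d = j by lia.
by rewrite nth_code //; apply: gen; lia.
Qed.

Lemma code_id q : all (pred1 0) (code q) -> q = 1.
Proof.
move=> /allP q0; apply/permP => j; rewrite perm1; apply: val_inj => /=.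
have mono (k l : 'I_n.+1) : k < l -> q k < q l.
  move=> lt_kl; have : ecode q l == 0.
    by apply: q0; apply: map_f; rewrite mem_iota /=.
  rewrite cards_eq0 => /eqP/setP/(_ k); rewrite !inE lt_kl inord_val /=.
  by move/negbT; rewrite -leqNgt leq_eqVlt (inj_eq val_inj) (inj_eq perm_inj) -val_eqE ltn_eqF.
rewrite -(card_ord_lt (ltnW (ltn_ord j))) -(card_ord_lt (ltnW (ltn_ord (q j)))).
rewrite -[RHS](card_imset _ (@perm_inj _ q)).
apply: eq_card => k; rewrite inE; apply/idP/imsetP => [lt_k|[l]]; last first.
  by rewrite inE => /mono lt ->.
exists (q^-1 k); last by rewrite permKV.
rewrite inE ltnNge leq_eqVlt negb_or -leqNgt.
move: lt_k; rewrite -{1}[k](permKV q); set l := q^-1 k => lt_l.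
case: (ltngtP j l) => //= [/mono|jl]; first by lia.
by move: lt_l; rewrite (val_inj jl) ltnn.
Qed.

Lemma code1 : all (pred1 0) (code 1).
Proof.
apply/allP => x /mapP[j]; rewrite mem_iota => /andP[_ lt_jn] -> /=.
rewrite cards_eq0; apply/eqP/setP => k; rewrite !inE !perm1 inordK //; lia.
Qed.
End Hecke.
Arguments adj {n} i.
Arguments code : simpl never.

Section HeckeSum.
Variable n : nat.
Implicit Types (s t : 'S_n.+1) (w u : seq nat).

Definition hecke_word w s := foldl (fun t i => hecke i t) s w.

(** The Coxeter length. It is read from the code of the inverse because [hecke_left] acts on the
    values of [s], which are the places of its inverse. *)
Definition len s := sumn (code s^-1%g).

(** On the identity the two actions of [i] agree, and the action on values commutes with all letters
    of [w]. This allows the first letter of a word to be peeled off last. *)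
Lemma hecke_word_cons i w : (i < n)%N -> all (gtn n) w ->
  hecke_word (i :: w) 1%g = hecke_left i (hecke_word w 1%g).
Proof.
move=> lt_in wn.
have hi : @inord n i = i :> nat by rewrite inordK //; lia.
have hi1 : @inord n i.+1 = i.+1 :> nat by rewrite inordK //; lia.
have -> : hecke_word (i :: w) 1%g = hecke_word w (hecke_left i 1%g).
  by rewrite /= /hecke /hecke_left invg1 !perm1 mulg1 mul1g.
elim: w 1%g wn => //= j w IH s /andP[lt_jn wn].
by rewrite hecke_comm // IH.
Qed.

Lemma sumn_swap i (c : seq nat) : (nth 0 c i < nth 0 c i.+1)%N ->
  sumn c = (sumn (code_swap i c)).+1.
Proof.
move=> lt_c; have lt_i : (i.+1 < size c)%N.
  by rewrite ltnNge; apply: contraTN lt_c => /(nth_default 0%N)->.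
have := cat_take_drop i c; rewrite (drop_nth 0%N (ltnW lt_i)) (drop_nth 0%N lt_i).
move=> {1}<-; rewrite /code_swap !sumn_cat /=; lia.
Qed.

Lemma code_mul_adj i s : (i < n)%N ->
    (s^-1%g (inord i.+1) < s^-1%g (inord i))%N ->
  code (s * adj i)^-1%g = code_swap i (code s^-1%g) /\ len s = (len (s * adj i)%g).+1.
Proof.
move=> lt_in desc; have code_eq : code (s * adj i)^-1%g = code_swap i (code s^-1%g).
  by rewrite invMg /adj tpermV code_adj.
by split=> //; rewrite /len code_eq; apply: sumn_swap; rewrite !nth_code ?ecode_descent // ltnW.
Qed.

Lemma hecke_left_mulK i s : (i < n)%N -> (s^-1%g (inord i) < s^-1%g (inord i.+1))%N ->
  ((s * adj i)^-1%g (inord i.+1) < (s * adj i)^-1%g (inord i))%N.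
Proof. by move=> lt_in lt_s; rewrite invMg /adj tpermV !permM tpermL tpermR. Qed.

Lemma len_hecke_word w : all (gtn n) w -> (len (hecke_word w 1%g) <= size w)%N.
Proof.
elim: w => [_|i w IH].
  rewrite /= /len invg1 leqn0; have /allP c0 := code1 n.
  by rewrite sumnE; apply/eqP; rewrite big_seq big1 // => x /c0/eqP.
move=> iwn; case/andP: (iwn) => lt_in wn.
rewrite hecke_word_cons // /hecke_left; case: ifP => [lt_s|_]; last exact: leqW (IH wn).
have [_] := code_mul_adj lt_in (hecke_left_mulK lt_in lt_s).
by rewrite -mulgA adjK mulg1 => ->; rewrite ltnS IH.
Qed.

(* With [i] the first letter of the word, the subwords using [i] have product [s]
   either because the rest multiplies to [s * adj i], or because it multiplies to
   [s] already; the latter adds [x] to the weight 1 of not using [i]. *)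
Variables (A : comNzRingType) (x : A).

Lemma bubbleP w s : all (gtn n) w ->
  sub_sum w (fun u => if hecke_word u 1%g == s then x ^+ (size u - len s) else 0) =
  bubble (1 + x) w (code s^-1%g).
Proof.
elim: w s => [s _|i w IH s iwn].
  rewrite -[LHS]/(if 1%g == s then x ^+ (0 - len s) else 0) -[RHS]/((all (pred1 0%N) _)%:R).
  rewrite sub0n expr0; case: eqP => [<-|s1]; first by rewrite invg1 code1.
  by case c0: (all _ _) => //; case: s1; rewrite -[s]invgK (code_id c0) invg1.
have [lt_in wn] : (i < n)%N /\ all (gtn n) w by apply/andP.
have le_in := ltnW lt_in.
rewrite sub_sum_cons bubble_cons IH //.
rewrite !nth_code // ecode_descent //.
have subw u : {subset u <= w} -> all (gtn n) u by move=> uw; apply/allP => y /uw /(allP wn).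
case: ifP => desc; last first.
  (* A product whose first letter is [i] has a descent of its inverse at [i], so no subword using
     [i] contributes. *)
  rewrite (eq_sub_sum (G := fun=> 0)) ?sub_sum0 ?addr0 // => u /subw un.
  rewrite -/(hecke_word (i :: u) 1%g) hecke_word_cons //; case: eqP => // s_def; move: desc.
  rewrite -s_def /hecke_left; case: ifP => [/(hecke_left_mulK lt_in)->//|].
  move/negbT; rewrite -leqNgt leq_eqVlt => /orP[/eqP/val_inj/perm_inj/(congr1 val)|->//].
  by rewrite /= !inordK; [move=> abs; exfalso; lia|lia|lia].
have [<- len_s] := code_mul_adj lt_in desc.
rewrite (eq_sub_sum (G := fun u =>
  (if hecke_word u 1%g == (s * adj i)%g then x ^+ (size u - len (s * adj i)%g) else 0) +
  x * (if hecke_word u 1%g == s then x ^+ (size u - len s) else 0))).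
  by rewrite sub_sumD sub_sumZ !IH //; ring.
move=> u /subw un.
rewrite -/(hecke_word (i :: u) 1%g) hecke_word_cons //; have lenu := len_hecke_word un.
set t := hecke_word u 1%g in lenu *; rewrite /hecke_left.
have ne_s : s != (s * adj i)%g by apply/eqP => s_s; move: len_s; rewrite {1}s_s; lia.
have [t_s|t_s] := eqVneq t s.
  rewrite t_s (negPf ne_s) add0r ltnNge ltnW //= eqxx -exprS; congr (_ ^+ _).
  by rewrite subSn // -t_s.
rewrite mulr0 addr0.
have [t_s'|t_s'] := eqVneq t (s * adj i)%g.
  have t_adj : (t * adj i)%g = s by rewrite t_s' -mulgA adjK mulg1.
  have := hecke_left_mulK lt_in; rewrite t_s'.
  rewrite invMg /adj tpermV !permM tpermL tpermR desc -/(adj i) -mulgA adjK mulg1 eqxx => _.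
  by congr (_ ^+ _); rewrite len_s subSS.
case: (_ < _)%N; last by rewrite (negPf t_s).
case: eqP => // ts; case/eqP: t_s'; by rewrite -ts -mulgA adjK mulg1.
Qed.
End HeckeSum.

(** * Codes of dominant permutations *)

Local Open Scope nat_scope.

Section Dominant.
Variables (n : nat) (pi : 'S_n.+1).
Hypothesis pi_dom : one_dominant pi.
Let q : 'S_n.+1 := pi^-1%g.

Lemma inv_pi0 : q ord0 = ord0.
Proof. by rewrite /q -[in LHS](proj1 pi_dom) permK. Qed.

Lemma inv_pi_gt0 (a : 'I_n.+1) : 0 < a -> 0 < q a.
Proof.
move=> a0; rewrite lt0n; apply: contraTN a0 => /eqP qa0.
have /perm_inj-> : q a = q ord0 by rewrite inv_pi0; apply: val_inj.
by [].
Qed.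

(** The pattern 132 is its own inverse, so its avoidance passes from [pi] to [q]. *)
Lemma inv_pi_132 (a b c : 'I_n.+1) : 0 < a -> a < b -> b < c -> q a < q c -> q b < q c.
Proof.
move=> a0 lt_ab lt_bc lt_ac; rewrite ltnNge; apply/negP.
rewrite leq_eqVlt => /orP[/eqP/val_inj|lt_cb].
  by move/perm_inj=> e; move: lt_bc; rewrite e ltnn.
by have /(_ (inv_pi_gt0 a0) lt_ac lt_cb) := proj2 pi_dom (q a) (q c) (q b); rewrite !permKV; apply.
Qed.

Lemma perm_lt (s : 'S_n.+1) (a b : 'I_n.+1) : a != b -> s a <= s b -> s a < s b.
Proof.
by move=> ab le; rewrite ltn_neqAle le andbT (inj_eq val_inj) (inj_eq perm_inj).
Qed.

Lemma ecode0 : ecode q 0 = 0.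
Proof. by apply/eqP; rewrite cards_eq0; apply/eqP/setP => k; rewrite !inE. Qed.

Lemma ecode_lt a : 0 < a < n.+1 -> ecode q a < a.
Proof.
case/andP=> a0 lt_an; rewrite -[X in _ < X](@card_ord_lt n); last exact: ltnW.
apply: proper_card; apply/properP; split.
  by apply/fintype.subsetP => k; rewrite !inE => /andP[].
by exists ord0; rewrite !inE //= inv_pi0 andbF.
Qed.

(** If [q j < q a], then each of the [a] places 1, ..., [a] carries a value above [q j], since a
    smaller value at [k] would make [k], [a], [j] a pattern 132. If [q a < q j], no place between
    [a] and [j] exceeds [q j], for the same reason, so the entry at [j] is at most the one at [a],
    which is below [a]. *)
Lemma ecode_ge (a j : 'I_n.+1) : 0 < a -> a < j -> (a <= ecode q j) = (q j < q a).
Proof.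
move=> a0 lt_aj; case: ltnP => [lt_q|le_q].
  have -> : nat_of_ord a = #|[set l : 'I_n.+1 | l < a.+1] :\ ord0|.
    have := cardsD1 (ord0 : 'I_n.+1) [set l : 'I_n.+1 | l < a.+1].
    by rewrite card_ord_lt // inE /=; case.
  apply/subset_leq_card/fintype.subsetP => k; rewrite !inE inord_val -val_eqE /= => /andP[k0].
  rewrite ltnS leq_eqVlt => /orP[/eqP/val_inj->|lt_ka]; first by rewrite lt_aj lt_q.
  rewrite (ltn_trans lt_ka) //= ltnNge; apply/negP => le_kj.
  have lt_kj : q k < q j by apply: perm_lt => //; rewrite -val_eqE /=; lia.
  have := @inv_pi_132 k a j; rewrite lt0n k0 => /(_ isT lt_ka lt_aj lt_kj).
  by rewrite ltnNge ltnW.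
have lt_q : q a < q j by apply: perm_lt => //; rewrite -val_eqE /=; lia.
apply/negbTE; rewrite -ltnNge; apply: leq_ltn_trans (ecode_lt (a := a) _); last by rewrite a0 /=.
apply/subset_leq_card/fintype.subsetP => k; rewrite !inE !inord_val => /andP[lt_kj lt_jk].
rewrite (ltn_trans lt_q lt_jk) andbT ltnNge; apply/negP.
rewrite leq_eqVlt => /orP[/eqP/val_inj ak|lt_ak].
  by move: lt_jk; rewrite -ak; lia.
have := @inv_pi_132 a k j a0 lt_ak lt_kj lt_q; lia.
Qed.

Lemma ecode_dom a j : 0 < a -> a < j < n.+1 -> (ecode q j <= ecode q a) || (a <= ecode q j).
Proof.
move=> a0 /andP[lt_aj lt_jn].
have := @ecode_ge (inord a) (inord j); rewrite !inordK //; last by apply: ltn_trans lt_jn.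
move=> -> //; rewrite orbC; case: ltnP => //= le_q.
have lt_q : q (inord a) < q (inord j).
  by apply: perm_lt => //; rewrite -val_eqE /= !inordK //; lia.
apply/subset_leq_card/fintype.subsetP => k; rewrite !inE => /andP[lt_kj lt_jk].
rewrite (ltn_trans lt_q lt_jk) andbT ltnNge; apply/negP; rewrite leq_eqVlt => /orP[/eqP ak|lt_ak].
  by move: lt_jk; rewrite ak inord_val in lt_q * => ?; lia.
have := @inv_pi_132 (inord a) k (inord j); rewrite !inordK //; last by lia.
by move=> /(_ a0 lt_ak lt_kj lt_q); lia.
Qed.

(** The length of row [a] of the diagram of [pi], hence for [a > 0] a part of the partition of
    pi'. *)
Definition row_len a := #|[set k : 'I_n.+1 | (a < k) && (q k < q (inord a))]|.

Lemma row_lenE a : 0 < a <= n ->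
  row_len a = count (leq a) [seq ecode q j | j <- iota a.+1 (n - a)].
Proof.
move=> /andP[a0 le_an].
rewrite /row_len; under eq_finset => k do rewrite -[k in q k]inord_val.
pose P k := (a < k) && (q (inord k) < q (inord a)).
have -> : #|[set k : 'I_n.+1 | (a < k) && (q (inord k) < q (inord a))]| =
    count P (iota 0 n.+1) := card_ord_count _ P.
have {1}-> : n.+1 = a.+1 + (n - a) by lia.
rewrite iotaD count_cat count_map.
have -> : count P (iota 0 a.+1) = 0.
  apply/eqP; rewrite -leqn0 leqNgt -has_count; apply/hasPn => x.
  by rewrite mem_iota => /andP[_ le_xa]; rewrite /P ltnNge; have -> : x <= a by lia.
apply: eq_in_count => j; rewrite mem_iota => /andP[lt_aj lt_jn] /=.
rewrite /P lt_aj /=; have := @ecode_ge (inord a) (inord j).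
by rewrite !inordK; [move=> ->|lia|lia].
Qed.

Lemma row_len_gt a : n <= a -> row_len a = 0.
Proof.
move=> le_na; apply/eqP; rewrite cards_eq0; apply/eqP/setP => k; rewrite !inE.
by apply/negbTE; rewrite negb_and -leqNgt; have := ltn_ord k; lia.
Qed.

(** By [row_lenE] the row counts the later entries that are at least [a]; those equal to [a] are
    split off. The multiplicities in [code_word] are thus the horizontal steps of the boundary of
    the partition. *)
Lemma row_lenS a : 0 < a -> row_len a = row_len a.+1 + code_mult n.+1 (ecode q) a.
Proof.
move=> a0; have [le_na|lt_an] := leqP n a.
  rewrite !row_len_gt //; last exact: leqW.
  by rewrite /code_mult; have -> : n.+1 - a.+1 = 0 by lia.
rewrite !row_lenE ?a0 ?(ltnW lt_an) //.
have -> : count (leq a.+1) [seq ecode q j | j <- iota a.+2 (n - a.+1)] =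
    count (leq a.+1) [seq ecode q j | j <- iota a.+1 (n - a)].
  have -> : n - a = (n - a.+1).+1 by lia.
  by rewrite /= leqNgt ecode_lt.
rewrite /code_mult subSS -count_predUI [X in _ = _ + X](@eq_count _ _ pred0).
  by rewrite count_pred0 addn0; apply: eq_count => x /=; rewrite leq_eqVlt orbC eq_sym.
by move=> x /=; case: eqP => [->|]; rewrite ?andbF // ltnn.
Qed.

Lemma sorted_row_len a : 0 < a -> row_len a.+1 <= row_len a.
Proof. by move=> a0; rewrite [row_len a]row_lenS // leq_addr. Qed.

Lemma bubble_dominant (A : comNzRingType) (b : A) :
  bubble b (flatten [seq iota a (n - a) | a <- rev (iota 0 n.+1)]) (code q) =
  word_poly b (code_word n.+1 (ecode q) n) 0.
Proof.
have := @bubble_rows A b n.+1 (code q) [::].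
rewrite size_map size_iota cats0 addn0 => -> //.
apply: (@passes_word A b n.+1 (ecode q) _ _ n [::] 0) => //.
- exact: ecode_lt.
- by move=> a j; apply: ecode_dom.
- exact: ecode0.
- by rewrite subnn.
Qed.
End Dominant.

(** * The sweep as a word in the 0-Hecke monoid *)

Section Sweep.
Variable n : nat.
Local Notation N := n.+1.
Implicit Types (P : {set box N}) (s : 'S_N) (st : sweep_state N).

(** The frontier has more than [N] places. Those beyond the first [N] carry strands from below with
    their initial labels, since crosses in the triangle exchange only the first [N] places. *)
Definition extend s i := if i < N then nat_of_ord (s (inord i)) else i.

Lemma extend_inj s : injective (extend s).
Proof.
move=> i j; rewrite /extend; case: ltnP => iN; case: ltnP => jN //.
- by move/val_inj/perm_inj/(congr1 val); rewrite /= !inordK.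
- by move=> e; move: jN; rewrite -e leqNgt ltn_ord.
by move=> e; move: iN; rewrite e leqNgt ltn_ord.
Qed.

Lemma extend1 i : extend 1%g i = i.
Proof. by rewrite /extend perm1; case: ltnP => // iN; rewrite inordK. Qed.

Lemma extend_adj i s j : i < n ->
  extend (adj i * s)%g j = extend s (if j == i then i.+1 else if j == i.+1 then i else j).
Proof.
move=> lt_in; rewrite /extend permM; case: (ltnP j) => jN.
  have -> : adj i (inord j) = inord (if j == i then i.+1 else if j == i.+1 then i else j) :> 'I_N.
    apply: val_inj; rewrite /= adj_val // !inordK //; do ?case: ifP; lia.
  by case: ltnP => //; do ?case: ifP; lia.
by do ?case: ifP; lia.
Qed.

Definition pair_of (l : nat -> nat) i j := (minn (l i) (l j), maxn (l i) (l j)).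

Lemma pair_of_inj (l : nat -> nat) i j i' j' : injective l -> i < j -> i' < j' ->
  pair_of l i j = pair_of l i' j' -> i = i' /\ j = j'.
Proof.
move=> l_inj lt_ij lt_ij' [emin emax].
have [[/l_inj e1 /l_inj e2]|[/l_inj e1 /l_inj e2]] :
    (l i = l i' /\ l j = l j') \/ (l i = l j' /\ l j = l i') by lia.
  by [].
by lia.
Qed.

(* The frontier of the part of the grid that was swept is read from the top left
   corner to the right; [s] is the word of its first [N] strands. *)
Record swept (a b : nat) st s : Prop := Swept {
  swept_left : forall i : 'I_N, i < a -> west st i = extend s i;
  swept_here : forall i : 'I_N, i = a :> nat -> b < N -> west st i = extend s (a + b);
  swept_top : forall c : 'I_N, c < b -> south st c = extend s (a + c);
  swept_below : forall c : 'I_N, b <= c -> south st c = extend s (a + c).+1;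
  swept_met : forall i j, i < j ->
    (pair_of (extend s) i j \in met st) = (extend s j < extend s i);
  swept_word : exists w, [/\ all (gtn n) w, hecke_word w 1%g = s,
    size w <= size (met st) & (size w < size (met st)) || uniq (met st)] }.

Lemma swept_init : swept n 0 (sweep_init N) 1%g.
Proof.
split=> //=.
- by move=> i _; rewrite extend1.
- by move=> i -> _; rewrite extend1 addn0.
- by move=> c _; rewrite extend1 addSn.
- by move=> i j lt_ij; rewrite !extend1 in_nil; lia.
by exists [::].
Qed.

Lemma swept_row a st s : swept a.+1 N st s -> swept a 0 st s.
Proof.
case=> sl _ st_ _ sm sw; split=> //.
- by move=> i lt_ia; apply: sl; apply: ltnW.
- by move=> i ia _; rewrite sl ia ?addn0.
by move=> c _; rewrite st_.
Qed.

(** The strands at the tile stand at the adjacent places [t.1 + t.2] and its successor of the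
    frontier, and they have met exactly if they are inverted there. Ignoring a second crossing is
    therefore the 0-Hecke rule. An elbow moves the frontier across the tile without changing its
    word. *)
Lemma swept_tile P (t : box N) st s : (t \in P -> t.1 + t.2 < n) ->
    swept t.1 t.2 st s ->
  let s' := if t \in P then hecke (t.1 + t.2) s else s in
  swept t.1 t.2.+1 (sweep_tile P st t) s' /\
  size (met (sweep_tile P st t)) = (t \in P) + size (met st).
Proof.
case: t => a b /= Pt [sl sh sp sb sm sw]; rewrite /sweep_tile /=.
have ua : west st a = extend s (a + b) by apply: sh.
have vb : south st b = extend s (a + b).+1 by apply: sb.
have elbow st' : west st' =1 [eta west st with a |-> south st b] ->
    south st' =1 [eta south st with b |-> west st a] ->
    met st' =i met st ->
    (exists w, [/\ all (gtn n) w, hecke_word w 1%g = s,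
      size w <= size (met st') & (size w < size (met st')) || uniq (met st')]) ->
    swept a b.+1 st' s.
  move=> wE sE mE w'; split=> //.
  - by move=> i lt_ia; rewrite wE /= -val_eqE /= ltn_eqF // sl.
  - by move=> i ia bN; rewrite wE /= -val_eqE /= ia eqxx vb addnS.
  - move=> c; rewrite ltnS leq_eqVlt sE /= -val_eqE /=.
    by case: eqP => [->//|_] /= lt_cb; rewrite sp.
  - by move=> c lt_bc; rewrite sE /= -val_eqE /= gtn_eqF // sb // ltnW.
  by move=> i j lt_ij; rewrite mE sm.
have [Pab|nPab] := boolP ((a, b) \in P); last by split=> //; apply: elbow.
have lt_ab := Pt Pab.
have uvE : (minn (west st a) (south st b), maxn (west st a) (south st b)) =
  pair_of (extend s) (a + b) (a + b).+1 by rewrite ua vb.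
rewrite uvE sm //= -leqNgt.
have extab : extend s (a + b) = s (inord (a + b)) by rewrite /extend ltnW.
have extab1 : extend s (a + b).+1 = s (inord (a + b).+1) by rewrite /extend ltnS lt_ab.
case: leqP => [le_s|lt_s]; last first.
  split=> //; rewrite /hecke -extab -extab1 ltnNge ltnW //=.
  apply: elbow => //=.
    by move=> p; rewrite inE; case: eqP => // ->; rewrite sm.
  case: sw => w [wn ws ws' _]; exists w; split=> //; first exact: leqW.
  by rewrite ltnS ws'.
have {le_s}lt_s : extend s (a + b) < extend s (a + b).+1.
  by rewrite ltn_neqAle le_s andbT; apply/eqP => /extend_inj; lia.
split=> //; rewrite /hecke -extab -extab1 lt_s.
split=> /=.
- move=> i lt_ia; rewrite sl // extend_adj //.
  by rewrite !ltn_eqF //; lia.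
- move=> i ia bN; rewrite extend_adj // addnS eqxx gtn_eqF //.
  by rewrite -ua; congr west; apply: val_inj.
- move=> c; rewrite ltnS leq_eqVlt extend_adj // => /orP[/eqP/val_inj->|lt_cb].
    by rewrite eqxx vb.
  by rewrite sp // !ltn_eqF //; lia.
- move=> c lt_bc; rewrite sb ?(ltnW lt_bc) // extend_adj //.
  by rewrite !gtn_eqF //; lia.
- move=> i j lt_ij; rewrite inE /pair_of !extend_adj // -/(pair_of (extend s) _ _).
  set i' := if i == _ then _ else _; set j' := if j == _ then _ else _.
  (* Only the pair at the two exchanged places changes its order, and it is the pair added to
     [met]. *)
  have [/andP[/eqP ei /eqP ej]|ne] := boolP ((i == a + b) && (j == (a + b).+1)).
    have -> : i' = (a + b).+1 by rewrite /i' ei eqxx.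
    have -> : j' = a + b by rewrite /j' ej eqxx gtn_eqF.
    by rewrite /pair_of minnC maxnC eqxx lt_s.
  have lt_ij' : i' < j' by move: ne; rewrite /i' /j'; do ?case: ifP; lia.
  rewrite sm //; case: eqP => //= /(pair_of_inj (@extend_inj s) lt_ij' (ltnSn _)).
  by move: ne; rewrite /i' /j'; do ?case: ifP; lia.
case: sw => w [wn ws ws' wu]; exists (rcons w (a + b)); split.
- by rewrite all_rcons /= lt_ab.
- by rewrite /hecke_word -cats1 foldl_cat -/(hecke_word w 1%g) ws /= /hecke -extab -extab1 lt_s.
- by rewrite size_rcons ltnS.
have -> : (pair_of (extend s) (a + b) (a + b).+1 \in met st) = false.
  by rewrite sm // ltnNge (ltnW lt_s).
by rewrite size_rcons ltnS.
Qed.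

Lemma swept_tiles P a b (r : seq 'I_N) st s (oa : 'I_N) : oa = a :> nat ->
    (forall c : 'I_N, (oa, c) \in P -> a + c < n) ->
    map val r = iota b (N - b) -> b <= N -> swept a b st s ->
  let st' := foldl (sweep_tile P) st [seq (oa, c) | c <- r] in
  let w := [seq a + c | c : 'I_N <- r & (oa, c) \in P] in
  swept a N st' (hecke_word w s) /\ size (met st') = size w + size (met st).
Proof.
move=> oaE Pa; elim: r b st s => [|c r IH] b st s.
  case: (ltnP b N) => [lt_bN|le_Nb _ le_bN /=]; first by have -> : N - b = (N - b.+1).+1 by lia.
  by have -> : b = N by lia.
case: (ltnP b N) => [lt_bN|le_Nb]; last by have -> : N - b = 0 by lia.
have -> : N - b = (N - b.+1).+1 by lia.
case=> cE rE _ sw; subst b.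
have [] := @swept_tile P (oa, c) st s; rewrite /= oaE //; first exact: Pa.
move=> sw' sz'; have [/= sw'' ->] := IH _ _ _ rE lt_bN sw'.
by move: sw''; rewrite sz'; case: ((oa, c) \in P) => /= sw''; split=> //; lia.
Qed.

Definition swept_below_row k st s : Prop :=
  if k is k'.+1 then swept k' 0 st s else swept 0 N st s.

Lemma swept_rows P k st s : k <= N -> P \subset triangle N -> 
    swept_below_row k st s ->
  let tiles := [seq (a, b) | a <- rev (take k (enum 'I_N)), b <- enum 'I_N] in
  let st' := foldl (sweep_tile P) st tiles in
  let w := [seq t.1 + t.2 | t : box N <- tiles & t \in P] in
  swept 0 N st' (hecke_word w s) /\ size (met st') = size w + size (met st).
Proof.
move=> le_kN /fintype.subsetP Ptri; elim: k le_kN st s => [|k IH] le_kN st s sw /=.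
  by rewrite take0.
rewrite (take_nth ord0) ?size_enum_ord // rev_rcons /= foldl_cat filter_cat map_cat.
set o := nth ord0 _ _; have oE : o = k :> nat by rewrite nth_enum_ord.
have [|||sw' sz'] := @swept_tiles P k 0 (enum 'I_N) st s o oE _ _ _ sw => //.
- by move=> c /Ptri; rewrite inE /= oE ltnS.
- by rewrite val_enum_ord subn0.
move: sw' sz'; set st1 := foldl _ _ _; set s1 := hecke_word _ _ => sw' sz'.
have {}sw' : swept_below_row k st1 s1 by case: (k) sw' => // k'; apply: swept_row.
have [sw'' ->] := IH (ltnW le_kN) st1 s1 sw'.
have wE : [seq t.1 + t.2 | t : box N <- [seq (o, c) | c <- enum 'I_N] & t \in P] =
    [seq k + c | c : 'I_N <- enum 'I_N & (o, c) \in P].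
  by rewrite filter_map -map_comp; apply: eq_map => c /=; rewrite oE.
rewrite wE /hecke_word foldl_cat size_cat; split=> //.
by rewrite sz' addnCA addnA.
Qed.

Definition tiles : seq (box N) := [seq (a, b) | a <- rev (enum 'I_N), b <- enum 'I_N].
Definition word P : seq nat := [seq t.1 + t.2 | t : box N <- tiles & t \in P].

Lemma sweepP P : P \subset triangle N ->
  swept 0 N (sweep P) (hecke_word (word P) 1%g) /\ size (met (sweep P)) = size (word P).
Proof.
move=> Ptri; have := swept_rows (leqnn N) Ptri swept_init.
by rewrite take_oversize ?size_enum_ord //= addn0.
Qed.

Lemma exit_top_word P b : P \subset triangle N -> exit_top P b = hecke_word (word P) 1%g b.
Proof.
by move=> /sweepP[[_ _ st_ _ _ _] _]; rewrite /exit_top st_ // /extend ltn_ord inord_val.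
Qed.

Lemma tiles_uniq : uniq tiles.
Proof. by rewrite allpairs_uniq ?rev_uniq ?enum_uniq //; move=> [a b] [c d] _ _ []-> ->. Qed.

Lemma mem_tiles t : t \in tiles.
Proof. by case: t => a b; apply/allpairsP; exists (a, b); rewrite mem_rev !mem_enum. Qed.

Lemma size_word P : size (word P) = #|P|.
Proof.
rewrite size_map -(card_uniqP (filter_uniq _ tiles_uniq)); apply: eq_card => t.
by rewrite mem_filter mem_tiles andbT.
Qed.

Lemma word_lt P : P \subset triangle N -> all (gtn n) (word P).
Proof.
move=> /fintype.subsetP Ptri; apply/allP => x /mapP[t]; rewrite mem_filter => /andP[/Ptri].
by rewrite inE ltnS => ? _ ->.
Qed.

Lemma PipesE (pi : 'S_N) P :
  (P \in Pipes pi) = (P \subset triangle N) && (hecke_word (word P) 1%g == pi).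
Proof.
rewrite inE; case: (boolP (P \subset _)) => //= Ptri.
apply/forallP/eqP => [eqs|<- b]; last by rewrite exit_top_word.
by apply/permP => b; apply: val_inj; have /eqP := eqs b; rewrite exit_top_word.
Qed.

Lemma len_Pipes (pi : 'S_N) P : P \in Pipes pi -> len pi <= #|P|.
Proof.
by rewrite PipesE => /andP[Ptri /eqP<-]; rewrite -size_word len_hecke_word ?word_lt.
Qed.

(* An ignored cross could be omitted, giving a word shorter than the length. *)
Lemma reduced_Pipes (pi : 'S_N) P : P \in Pipes pi -> #|P| = len pi -> reduced P.
Proof.
rewrite PipesE => /andP[Ptri /eqP <-] cardP.
have [[_ _ _ _ _ [w [wn ws _ lt_w]]] sz] := sweepP Ptri.
by move: lt_w; rewrite sz size_word cardP -ws ltnNge len_hecke_word.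
Qed.

(** Every pipe dream has at least [len pi] crosses, and one with exactly that many is reduced, so
    the elbows of [P0] form a face of largest size. The existence of [P0] is established in
    [ex_min_Pipes]. *)
Lemma codim_elbows (pi : 'S_N) P P0 : P0 \in Pipes pi -> #|P0| = len pi ->
  P \in Pipes pi -> codim pi (elbows P) = #|P| - len pi.
Proof.
move=> P0pi cardP0 Ppi.
have card_elbows Q : Q \in Pipes pi -> #|elbows Q| + #|Q| = #|triangle N|.
  by rewrite inE => /andP[Qtri _]; rewrite cardsD (setIidPr Qtri) subnK // subset_leq_card.
rewrite /codim; have -> : \max_(G in PD pi) #|G| = #|triangle N| - len pi.
  apply/eqP; rewrite eqn_leq; apply/andP; split.
    apply/bigmax_leqP => G; rewrite inE => /existsP[Q /and3P[Qpi _ /subset_leq_card GQ]].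
    by have := card_elbows Q Qpi; have := len_Pipes Qpi; lia.
  have -> : #|triangle N| - len pi = #|elbows P0| by have := card_elbows P0 P0pi; lia.
  apply: leq_bigmax_cond; rewrite inE; apply/existsP; exists P0.
  by rewrite P0pi (reduced_Pipes P0pi) /=.
have := card_elbows P Ppi; have := len_Pipes Ppi; lia.
Qed.
End Sweep.

(** * Pipe dreams as subwords and the Grothendieck polynomial *)

Local Open Scope ring_scope.

Lemma sum_subset_sub_sum (A : comNzRingType) (T : finType) (f : T -> nat) (r : seq T)
    (F : seq nat -> A) : uniq r ->
  \sum_(P : {set T} | P \subset r) F [seq f t | t <- r & t \in P] = sub_sum (map f r) F.
Proof.
elim: r F => [|t r IH] F /=.
  rewrite (bigD1 set0) /=; last by apply/fintype.subsetP => x; rewrite inE.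
  rewrite big1 ?addr0 // => P /andP[/fintype.subsetP P0].
  by case: (set_0Vmem P) => [->|[x /P0]]; rewrite ?eqxx.
case/andP=> tr ur; rewrite (bigID (fun P : {set T} => t \in P)) /= addrC.
have tr' x : x \in r -> x != t by move=> xr; apply: contraNneq tr => <-.
congr (_ + _).
  rewrite -IH //; apply: eq_big => [P|P /andP[_ /negPf->] //].
  apply/andP/idP => [[/fintype.subsetP Pr tP]|/fintype.subsetP Pr].
    apply/fintype.subsetP => x xP; have := Pr x xP; rewrite inE => /predU1P[x_t|//].
    by rewrite x_t in xP; rewrite xP in tP.
  split; last by apply: contra tr => /Pr.
  by apply/fintype.subsetP => x /Pr; rewrite inE orbC => ->.
rewrite (reindex_onto (fun P => t |: P) (fun P => P :\ t)) /=; last first.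
  by move=> P /andP[_ tP]; rewrite setD1K.
rewrite -(IH (fun u => F (f t :: u))) //; apply: eq_big => [P|P /andP[_ _]].
  rewrite setU11 andbT; apply/andP/idP => [[/fintype.subsetP Pr /eqP Pt]|/fintype.subsetP Pr].
    apply/fintype.subsetP => x xP; have := Pr x; rewrite !inE xP orbT => /(_ isT) /predU1P[x_t|//].
    by move: xP; rewrite -Pt x_t !inE eqxx.
  split; last by rewrite setU1K //; apply: contra tr => /Pr.
  by apply/fintype.subsetP => x; rewrite !inE => /predU1P[->|/Pr->]; rewrite ?eqxx ?orbT.
rewrite setU11 /=; congr (F (_ :: map f _)).
by apply: eq_in_filter => x /tr' xt; rewrite !inE (negPf xt).
Qed.

Section Pipes.
Variable n : nat.
Local Notation N := n.+1.

Lemma triangle_letters :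
  [seq (t.1 + t.2)%N | t : box N <- tiles n & t \in triangle N] =
  flatten [seq iota a (n - a) | a <- rev (iota 0 N)].
Proof.
rewrite /tiles filter_flatten map_flatten -!map_comp -val_enum_ord -map_rev -map_comp.
congr flatten; apply: eq_map => a /=; rewrite filter_map -map_comp.
rewrite (eq_filter (a2 := fun b : 'I_N => (b < n - a)%N)); last first.
  by move=> b; rewrite /= inE /=; lia.
transitivity [seq (a + b)%N | b <- [seq b <- [seq val b | b <- enum 'I_N] | (b < n - a)%N]].
  by rewrite filter_map -map_comp.
rewrite val_enum_ord.
have := @filter_iota_ltn 0 N (n - a) ltac:(lia); rewrite add0n => ->.
by rewrite -iotaDl addn0.
Qed.

Lemma sum_Pipes (A : comNzRingType) (x : A) (pi : 'S_N) : one_dominant pi ->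
  \sum_(P in Pipes pi) x ^+ (#|P| - len pi) =
  word_poly (1 + x) (code_word N (ecode pi^-1%g) n) 0.
Proof.
move=> pi_dom; rewrite -bubble_dominant // -triangle_letters -bubbleP; last first.
  rewrite triangle_letters; apply/allP => i /flattenP[_ /mapP[a _ ->]].
  by rewrite mem_iota /=; lia.
rewrite -sum_subset_sub_sum ?filter_uniq ?tiles_uniq //.
rewrite (eq_bigl _ _ (PipesE pi)) big_mkcondr /=.
have triE (P : {set box N}) :
    (P \subset [seq t <- tiles n | t \in triangle N]) = (P \subset triangle N).
  by apply: eq_subset_r => t; rewrite mem_filter mem_tiles andbT.
rewrite (eq_bigl _ _ triE); apply: eq_bigr => P /fintype.subsetP Ptri.
rewrite -filter_predI (eq_filter (a2 := fun t => t \in P)) -/(word P) ?size_word //.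
by move=> t /=; case: (boolP (t \in P)) => // /Ptri->.
Qed.

Lemma word_poly_gt0 w z : 0 < word_poly (1 : int) w z.
Proof.
elim: w z => [//|[e d] w IH] z /=; apply: ltr_wpDr; last exact: IH.
by case: d => //; rewrite mul1r sumr_ge0 // => y _; apply: ltW.
Qed.

(* The sum over pipe dreams is evaluated at 0, where only the minimal ones count. *)
Lemma ex_min_Pipes (pi : 'S_N) : one_dominant pi ->
  exists2 P, P \in Pipes pi & #|P| = len pi.
Proof.
move=> pi_dom; have := sum_Pipes (0 : int) pi_dom; rewrite addr0 => sumE.
have : \sum_(P in Pipes pi) (0 : int) ^+ (#|P| - len pi) != 0.
  by rewrite sumE gt_eqF // word_poly_gt0.
case: (pickP (fun P => (P \in Pipes pi) && (#|P| == len pi))) => [P /andP[Ppi /eqP]|noP].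
  by exists P.
rewrite big1 ?eqxx // => P Ppi; rewrite expr0n.
have := noP P; rewrite Ppi /= => /negbT ne; have := len_Pipes Ppi.
rewrite leq_eqVlt eq_sym (negPf ne) /= -subn_gt0 => lt.
by rewrite gtn_eqF.
Qed.

Lemma grothendieck_dominant (A : comNzRingType) (x : A) (pi : 'S_N) : one_dominant pi ->
  grothendieck pi x (fun=> 1) = word_poly (1 + x) (code_word N (ecode pi^-1%g) n) 0.
Proof.
move=> pi_dom; rewrite -sum_Pipes //; have [P0 P0pi cardP0] := ex_min_Pipes pi_dom.
apply: eq_bigr => P Ppi; rewrite (codim_elbows P0pi cardP0 Ppi).
by rewrite big1 ?mulr1.
Qed.
End Pipes.

(** * Generating series of lattice points *)

(* The lattice paths of height [h] at the start, never negative and 0 at the end,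
   whose increases add up to at most [s]. *)
Fixpoint lattice_count (w : seq (bool * bool)) (h s : nat) : nat :=
  if w is (e, d) :: w' then
    (lattice_count w' h s +
     (if e then \sum_(a < s) lattice_count w' (h + a.+1) (s - a.+1) else 0) +
     (if d then \sum_(y < h) lattice_count w' y s else 0))%N
  else (h == 0%N).

Section Series.
Implicit Types (f : nat -> nat -> int) (g : nat -> int).

(** A function of [s] is the coefficient sequence of a power series in beta. Then [shift] is
    multiplication by beta and [diff] by 1 - beta; [up] and [down] include the increase,
    respectively decrease, by 0. *)
Definition shift g s := if s is s'.+1 then g s' else 0.
Definition diff g s := g s - shift g s.
Definition up f h s := \sum_(a < s.+1) f (h + a)%N (s - a)%N.
Definition down f h s := \sum_(y < h.+1) f y s.
Definition countZ w h s : int := (lattice_count w h s)%:Z.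

Lemma countZ_cons e d w h s : countZ ((e, d) :: w) h s =
  countZ w h s + (if e then up (countZ w) h s - countZ w h s else 0)
  + (if d then down (countZ w) h s - countZ w h s else 0).
Proof.
rewrite /countZ /= !PoszD; congr (_ + _ + _).
  case: e => //; rewrite /up big_ord_recl /= addn0 subn0 addrC addKr.
  by rewrite (big_morph Posz PoszD (erefl _)).
case: d => //; rewrite /down big_ord_recr /= addrK.
by rewrite (big_morph Posz PoszD (erefl _)).
Qed.

Lemma countZ_up w : countZ ((true, false) :: w) = up (countZ w).
Proof. by apply: funext => h; apply: funext => s; rewrite countZ_cons addr0 addrC subrK. Qed.

Lemma countZ_down w : countZ ((false, true) :: w) = down (countZ w).
Proof. by apply: funext => h; apply: funext => s; rewrite countZ_cons addr0 addrC subrK. Qed.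

Lemma up0 f h : up f h 0 = f h 0%N.
Proof. by rewrite /up big_ord1 addn0. Qed.

Lemma upS f h s : up f h s.+1 = f h s.+1 + up f h.+1 s.
Proof.
rewrite /up big_ord_recl /= addn0 subn0; congr (_ + _); apply: eq_bigr => a _.
by rewrite /bump /= addnS addSn subSS.
Qed.

Lemma downS f h s : down f h.+1 s = down f h s + f h.+1 s.
Proof. by rewrite /down big_ord_recr. Qed.

Lemma diff_up f : (fun h => diff (up f h)) = up (fun h => diff (f h)).
Proof.
apply: funext => h; apply: funext => s; elim: s h => [|s IH] h.
  by rewrite up0 /diff /= up0.
rewrite upS -IH /diff /shift; case: s {IH} => [|s]; first by rewrite upS !up0; ring.
by rewrite upS [up f h s.+1]upS; ring.
Qed.

Lemma diff_iter_up k f : (fun h => diff (iter k up f h)) = iter k up (fun h => diff (f h)).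
Proof. by elim: k => //= k <-; rewrite -diff_up. Qed.

Lemma up_down f h s : up (down f) h.+1 s = up (down f) h s + up f h.+1 s.
Proof.
rewrite /up -big_split /=; apply: eq_bigr => a _.
by rewrite addSn downS.
Qed.

(* In terms of operators: (1 - beta) * up * down = up + down - 1. *)
Lemma diff_up_down f h s : diff (up (down f) h) s = up f h s + down f h s - f h s.
Proof.
case: s => [|s]; rewrite /diff /= ?up0 ?upS; first by ring.
by rewrite up_down; ring.
Qed.

Lemma countZ_corner w : countZ ((true, true) :: w) = fun h => diff (up (down (countZ w)) h).
Proof.
apply: funext => h; apply: funext => s.
by rewrite countZ_cons diff_up_down [countZ w h s + _]addrC subrK addrA.
Qed.

Lemma iter_up_lin k f1 f2 f3 h s :
  iter k up (fun h s => f1 h s + f2 h s - f3 h s) h s =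
  iter k up f1 h s + iter k up f2 h s - iter k up f3 h s.
Proof.
elim: k h s => //= k IH h s; rewrite /up -big_split -sumrB /=.
by apply: eq_bigr => a _; rewrite IH.
Qed.

Lemma iter_diff_lin k g1 g2 g3 s :
  iter k diff (fun s => g1 s + g2 s - g3 s) s =
  iter k diff g1 s + iter k diff g2 s - iter k diff g3 s.
Proof. by elim: k s => //= k IH [|s]; rewrite /diff /= !IH; ring. Qed.

Lemma eq_iter_diff k g1 g2 : g1 =1 g2 -> iter k diff g1 =1 iter k diff g2.
Proof. by move=> /funext->. Qed.

Lemma count_down1 h s : countZ [:: (false, true)] h s = 1.
Proof.
rewrite countZ_down /down big_ord_recl /= big1 ?addr0 //.
Qed.

(** Write H j for the left side of the conclusion. One application of (1 - beta) U D = U + D - 1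
    next to the D gives H j = H (j - 1) + G j - (1 - beta) G (j - 1), which telescopes to the right
    side. For j = 0 the first and third terms cancel, since [down] is trivial at height 0. *)
Lemma iter_diff_down r f (G : nat -> {poly int}) :
    (forall (k s : nat), iter (k.+1 + r) diff (iter k.+1 up f 0) s = (G k)`_s) ->
  forall (k s : nat), iter (k.+1 + r.+1) diff (iter k.+1 up (down f) 0) s =
    (G k + 'X * \sum_(y < k) G y)`_s.
Proof.
move=> fG.
have step j s : iter (j.+1 + r.+1) diff (iter j.+1 up (down f) 0) s =
    iter (j + r.+1) diff (iter j up (down f) 0) s + (G j)`_s
    - diff (iter (j + r) diff (iter j up f 0)) s.
  have -> : iter (j.+1 + r.+1) diff (iter j.+1 up (down f) 0) =
      iter (j + r.+1) diff
        (fun s => iter j up (down f) 0%N s + iter j.+1 up f 0%N s - iter j up f 0%N s).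
    rewrite addSn iterSr; apply: funext; apply: eq_iter_diff => t.
    have := congr1 (fun F => F 0%N t) (diff_iter_up j (up (down f))); rewrite -iterSr => ->.
    have -> : (fun h => diff (up (down f) h)) = fun h s => down f h s + up f h s - f h s.
      by apply: funext => h; apply: funext => u; rewrite diff_up_down; ring.
    by rewrite iter_up_lin -iterSr.
  by rewrite iter_diff_lin; congr (_ + _ - _); rewrite -?fG addnS.
elim=> [|j IH] s.
  rewrite step /= big_ord0 mulr0 addr0 -iterS.
  have -> : down f 0%N = f 0%N by apply: funext => t; rewrite /down big_ord1.
  by rewrite !add0n; ring.
rewrite step IH big_ord_recr /= mulrDr !coefD !coefXM.
have -> : diff (iter (j.+1 + r) diff (iter j.+1 up f 0)) s =
    (G j)`_s - (if s == 0%N then 0 else (G j)`_s.-1).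
  by rewrite /diff /shift; case: s {IH} => [|s]; rewrite !fG.
by case: eqP => _; ring.
Qed.

(** The number [k] carried by [word_poly] appears as [k.+1] operators [up]. Each of them, each
    letter of [w] and the final decrease contributes one factor 1 - beta; a letter allowing neither
    direction would break this count. *)
Lemma count_word_poly w k s : all (fun l => l.1 || l.2) w ->
  iter (k.+1 + (size w).+1) diff
    (iter k.+1 up (countZ (w ++ [:: (false, true)])) 0) s = (word_poly 'X w k)`_s.
Proof.
elim: w k s => [|[e d] w IH] k s.
  move=> _; rewrite cat0s [size _]/= [word_poly _ _ _]/=.
  have cst : countZ [:: (false, true)] = fun _ _ => 1.
    by apply: funext => h; apply: funext => t; rewrite count_down1.
  (* On a family independent of the height, [up] is division by 1 - beta, so it cancels against
     [diff]. *)
  have upd : up (fun h => diff (countZ [:: (false, true)] h)) = countZ [:: (false, true)].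
    rewrite cst; apply: funext => h; apply: funext => t.
    elim: t h => [|t IHt] h; first by rewrite up0 /diff /= subr0.
    by rewrite upS IHt /diff /= subrr add0r.
  rewrite addn1 [RHS]coef1 iterS.
  have -> : forall j, iter j diff (iter j up (countZ [:: (false, true)]) 0) =
      countZ [:: (false, true)] 0%N.
    elim=> // j IHj; rewrite iterSr.
    have := congr1 (fun F => F 0%N) (diff_iter_up j.+1 (countZ [:: (false, true)])) => /= e.
    by rewrite /= e -iterS iterSr upd.
  by rewrite cst /diff; case: s.
case/andP=> ed wed; rewrite cat_cons [size _]/=.
set f := countZ (w ++ [:: (false, true)]).
have fG j t := IH j t wed; rewrite -/f in fG.
case: e d ed => [] [] // _.
(* A corner is (1 - beta) U D: its U joins the leading ones, turning [k] into [k.+1], and its factor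
   1 - beta matches that additional U. *)
- have -> : iter k.+1 up (countZ ((true, true) :: w ++ [:: (false, true)])) =
      fun h => diff (iter k.+2 up (down f) h).
    by rewrite countZ_corner [in RHS]iterSr -diff_iter_up.
  rewrite -iterSr -addSn (iter_diff_down fG) /=.
  by [].
- by rewrite countZ_up -/f -iterSr -addSnnS fG /= addr0.
by rewrite countZ_down -/f (iter_diff_down fG).
Qed.
End Series.

(** * Lattice points of root polytopes *)

Section Enumeration.
Implicit Types (w : seq (bool * bool)).

Fixpoint feasible w (h s : int) (zs : seq int) : bool :=
  match w, zs with
  | [::], [::] => (h == 0) && (0 <= s)
  | (e, d) :: w', x :: zs' =>
      [&& e || (x <= 0), d || (0 <= x), 0 <= h + x &
          feasible w' (h + x) (s - Num.max x 0) zs']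
  | _, _ => false
  end.

(** The list follows the recursion of [lattice_count], so that its length is immediate; a decrease
    is indexed by the height [y] it reaches. *)
Fixpoint lattice_points w (h s : nat) : seq (seq int) :=
  if w is (e, d) :: w' then
    [seq 0 :: zs | zs <- lattice_points w' h s] ++
    ((if e then [seq a.+1%:Z :: zs | a <- iota 0 s, zs <- lattice_points w' (h + a.+1) (s - a.+1)]
      else [::]) ++
     (if d then [seq (y%:Z - h%:Z) :: zs | y <- iota 0 h, zs <- lattice_points w' y s]
      else [::]))
  else if h == 0%N then [:: [::]] else [::].

Lemma size_lattice_points w h s : size (lattice_points w h s) = lattice_count w h s.
Proof.
elim: w h s => [|[e d] w IH] h s /=; first by case: eqP.
have szE (r : nat) (L : nat -> seq (seq int)) (f : nat -> int) :
    size [seq f a :: zs | a <- iota 0 r, zs <- L a] = (\sum_(a < r) size (L a))%N.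
  rewrite size_allpairs_dep sumnE big_map -[r in iota 0 r]subn0 -/(index_iota 0 r).
  by rewrite big_mkord.
rewrite !size_cat size_map IH addnA; congr (_ + _ + _)%N.
  by case: e => //; rewrite szE; apply: eq_bigr => a _; rewrite IH.
by case: d => //; rewrite szE; apply: eq_bigr => a _; rewrite IH.
Qed.

Lemma lattice_points_uniq w h s : uniq (lattice_points w h s).
Proof.
elim: w h s => [|[e d] w IH] h s /=; first by case: eqP.
have uE (r : nat) (L : nat -> seq (seq int)) (f : nat -> int) :
    (forall a, uniq (L a)) -> injective f ->
    uniq [seq f a :: zs | a <- iota 0 r, zs <- L a].
  move=> uL f_inj; apply: allpairs_uniq_dep => //; first exact: iota_uniq.
  by move=> [a x] [b y] _ _ /= [/f_inj-> ->].
rewrite !cat_uniq map_inj_uniq ?IH; last by move=> ? ? [].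
rewrite /=; apply/and3P; split.
- apply/hasPn => zs; rewrite mem_cat => /orP[].
    case: e => // /allpairsPdep[a [z [_ _ ->]]].
    by apply/mapP => -[? _ []].
  case: d => // /allpairsPdep[a [z [ar _ ->]]].
  by apply/mapP => -[? _ [] e0]; move: ar; rewrite mem_iota; lia.
- by case: e => //; apply: uE => [a|a b []].
apply/andP; split.
  apply/hasPn => zs; case: d => // /allpairsPdep[y [z [yr _ ->]]].
  case: e => //; apply/negP => /allpairsPdep[a [z' [_ _ [e0 _]]]].
  by move: yr; rewrite mem_iota; lia.
by case: d => //; apply: uE => // a b; lia.
Qed.

Lemma feasible_ge0 w h s zs : feasible w h s zs -> 0 <= s.
Proof.
elim: w h s zs => [|[e d] w IH] h s [|x zs] //=; first by case/andP.
by case/and4P => _ _ _ /IH; rewrite subr_ge0; apply: le_trans; rewrite le_max lexx orbT.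
Qed.

Lemma mem_lattice_points w (h s : nat) zs :
  (zs \in lattice_points w h s) = feasible w h s zs.
Proof.
elim: w h s zs => [|[e d] w IH] h s zs /=.
  by case: zs => [|x zs]; case: h.
case: zs => [|x zs].
  apply/negP; rewrite !mem_cat => /or3P[/mapP[]//| |].
    by case: e => // /allpairsPdep[? [? []]].
  by case: d => // /allpairsPdep[? [? []]].
apply/idP/and4P => [|[ex dx hx]].
  rewrite !mem_cat => /or3P[/mapP[z zin [-> ->]]| |].
  - by rewrite lexx !orbT !addr0 -IH zin.
  - case: e => // /allpairsPdep[a [z [ar zin [-> ->]]]].
    move: ar; rewrite mem_iota => /= lt_as.
    rewrite -PoszD /= orbT; split=> //.
    by move: zin; rewrite IH [Num.max _ _]max_l // -subzn.
  case: d => // /allpairsPdep[y [z [yr zin [-> ->]]]].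
  move: yr; rewrite mem_iota => /= lt_yh.
  have -> : h%:Z + (y%:Z - h%:Z) = y by lia.
  have neg : y%:Z - h%:Z <= 0 by lia.
  by rewrite neg orbT max_r // subr0 -IH.
rewrite !mem_cat; case: (ltgtP x 0) ex dx hx => [x0|x0|->] ex dx hx fz.
- apply/orP; right; apply/orP; right.
  have -> : d by move: dx; rewrite orbF.
  apply/allpairsPdep; exists (absz (h%:Z + x)), zs; rewrite mem_iota IH.
  have hE : (absz (h%:Z + x))%:Z = h%:Z + x by lia.
  rewrite hE; split; [lia| |congr cons; lia].
  by move: fz; rewrite subr0.
- apply/orP; right; apply/orP; left.
  have -> : e by move: ex; rewrite orbF.
  have sx := feasible_ge0 fz.
  apply/allpairsPdep; exists (absz x).-1, zs; rewrite mem_iota IH.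
  have xE : (absz x).-1.+1%:Z = x by lia.
  rewrite -subzn; last by lia.
  by rewrite PoszD xE; split=> //; lia.
apply/orP; left; apply/mapP; exists zs => //; rewrite IH.
by move: fz; rewrite addr0 ?maxxx ?subr0.
Qed.

Lemma feasible_map (T : eqType) (Et Nt : pred T) (z : T -> int) (r : seq T) (h s : int) : 0 <= h ->
  feasible [seq (Et i, Nt i) | i <- r] h s [seq z i | i <- r] <->
  [/\ forall i, i \in r -> (Et i || (z i <= 0)) && (Nt i || (0 <= z i)),
      forall k, 0 <= h + \sum_(i <- take k r) z i,
      h + \sum_(i <- r) z i = 0 & \sum_(i <- r) Num.max (z i) 0 <= s].
Proof.
elim: r h s => [|i r IH] h s h0 /=.
  rewrite !big_nil !addr0; split=> [/andP[/eqP-> s0]|[_ _ -> ->]]; last by rewrite eqxx.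
  by split=> // k; rewrite big_nil.
split=> [/and4P[ei di hi /IH[//|sr tr sum mx]]|[sr tr sum mx]].
  rewrite !big_cons; split.
  - by move=> j; rewrite inE => /predU1P[->|/sr//]; rewrite ei di.
  - by case=> [|k]; rewrite ?big_nil ?addr0 // big_cons addrA.
  - by rewrite addrA.
  by rewrite addrC -lerBrDr.
have /andP[ei di] := sr i (mem_head _ _).
have hi : 0 <= h + z i by have := tr 1%N; rewrite /= take0 big_cons big_nil addr0.
rewrite ei di hi; apply/IH => //; split.
- by move=> j jr; apply: sr; rewrite inE jr orbT.
- by move=> k; have := tr k.+1; rewrite big_cons addrA.
- by move: sum; rewrite big_cons addrA.
by move: mx; rewrite big_cons lerBrDr addrC.
Qed.
End Enumeration.

Section RootPolytope.
Variables (R : realType) (m : nat) (e : rel 'I_m) (Et Nt : pred 'I_m).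
Hypothesis e_types : forall i j : 'I_m, (i < j)%N -> e i j -> Et i && Nt j.
Hypothesis e_paths : forall i j : 'I_m, (i < j)%N -> Et i -> Nt j ->
  root_cone e (root_vector R i j).

Definition pairing (A : pzRingType) (a : 'I_m -> A) (x : 'rV[A]_m) := \sum_l a l * x 0 l.

Lemma pairing_root (a : 'I_m -> R) i j : pairing a (root_vector R i j) = a i - a j.
Proof.
have dE k : \sum_l a l * (delta_mx ord0 k : 'rV[R]_m) 0 l = a k.
  rewrite (bigD1 k) //= mxE !eqxx mulr1 big1 ?addr0 // => l lk.
  by rewrite mxE (negPf lk) andbF mulr0.
rewrite -[in RHS]dE -[in RHS](dE j) -sumrB; apply: eq_bigr => l _.
by rewrite !mxE mulrBr.
Qed.

Lemma pairing_sum (I : finType) (P : pred I) (a : 'I_m -> R) (w : I -> R) (p : I -> 'rV[R]_m) :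
  pairing a (\sum_(t | P t) w t *: p t) = \sum_(t | P t) w t * pairing a (p t).
Proof.
rewrite /pairing; under eq_bigr => l _ do rewrite summxE mulr_sumr.
rewrite exchange_big; apply: eq_bigr => t _; rewrite mulr_sumr; apply: eq_bigr => l _.
by rewrite !mxE mulrCA.
Qed.

Lemma cone_pairing_ge0 (a : 'I_m -> R) x :
    (forall i j : 'I_m, (i < j)%N -> e i j -> a j <= a i) ->
  root_cone e x -> 0 <= pairing a x.
Proof.
move=> a_ge [w [w0 ->]].
have -> : \sum_(i < m) \sum_(j < m | (i < j)%N && e i j) w i j *: root_vector R i j =
    \sum_(i < m) 1 *: \sum_(j < m | (i < j)%N && e i j) w i j *: root_vector R i j.
  by apply: eq_bigr => i _; rewrite scale1r.
rewrite pairing_sum; apply: sumr_ge0 => i _; rewrite mul1r pairing_sum.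
apply: sumr_ge0 => j /andP[ij eij].
by rewrite mulr_ge0 // pairing_root subr_ge0 a_ge.
Qed.

Lemma polytope_pairing_ge0 (a : 'I_m -> R) x :
    (forall i j : 'I_m, (i < j)%N -> e i j -> a j <= a i) ->
  root_polytope R e x -> 0 <= pairing a x.
Proof.
move=> a_ge [k [p [w [pP w0 _ ->]]]].
rewrite pairing_sum; apply: sumr_ge0 => t _; apply: mulr_ge0 => //.
case: (pP t) => [->|[/cone_pairing_ge0 -> //]].
by rewrite /pairing big1 // => l _; rewrite mxE mulr0.
Qed.

Lemma polytope_pairing_le1 (a : 'I_m -> R) x :
    (forall i j : 'I_m, a i - a j <= 1) ->
  root_polytope R e x -> pairing a x <= 1.
Proof.
move=> a_le [k [p [w [pP w0 w1 ->]]]].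
rewrite pairing_sum -[leRHS]w1; apply: ler_sum => t _.
rewrite -[leRHS]mulr1 ler_wpM2l //.
case: (pP t) => [->|[_ [i [j [_ ->]]]]]; last by rewrite pairing_root.
by rewrite /pairing big1 // => l _; rewrite mxE mulr0.
Qed.

Definition in_dilate (z : 'rV[int]_m) (s : nat) :=
  feasible [seq (Et i, Nt i) | i <- enum 'I_m] 0 s [seq z 0 i | i <- enum 'I_m].

Lemma sum_take (A : nmodType) (F : 'I_m -> A) k :
  \sum_(i <- take k (enum 'I_m)) F i = \sum_(i < m | (i < k)%N) F i.
Proof.
rewrite big_uniq ?take_uniq ?enum_uniq //; apply: eq_bigl => i.
by rewrite in_take ?mem_enum // index_enum_ord.
Qed.

Lemma in_dilateP z s : in_dilate z s <->
  [/\ forall i, (Et i || (z 0 i <= 0)) && (Nt i || (0 <= z 0 i)),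
      forall k, 0 <= \sum_(i < m | (i < k)%N) z 0 i,
      \sum_(i < m) z 0 i = 0 & \sum_(i < m) Num.max (z 0 i) 0 <= s].
Proof.
rewrite /in_dilate feasible_map // !big_enum /=; split=> -[sg tr sm mx]; split=> //.
- by move=> i; apply: sg; rewrite mem_enum.
- by move=> k; have := tr k; rewrite add0r sum_take.
- by rewrite -[LHS]add0r.
- by move=> k; rewrite add0r sum_take.
by rewrite add0r.
Qed.

Lemma pairing_int (a : 'I_m -> int) (z : 'rV[int]_m) :
  pairing (fun l => (a l)%:~R) (map_mx intr z) = (pairing a z)%:~R :> R.
Proof. by rewrite /pairing rmorph_sum; apply: eq_bigr => l _; rewrite mxE rmorphM. Qed.

Lemma pairing_dilate (a : 'I_m -> int) (z : 'rV[int]_m) (s : nat) (x : 'rV[R]_m) :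
  s%:R *: x = map_mx intr z -> (pairing a z)%:~R = s%:R * pairing (fun l => (a l)%:~R) x :> R.
Proof.
move=> xz; rewrite -pairing_int -xz /pairing mulr_sumr; apply: eq_bigr => l _.
by rewrite mxE mulrCA.
Qed.

(** Each condition tests [z] against a linear functional with integer coefficients. Signs, partial
    sums and total come from functionals that are nonnegative on all edges; the bound [s] comes from
    the indicator of the positive coordinates of [z], which is at most 1 on every root vector. *)
Lemma dilate_feasible z s x : root_polytope R e x -> s%:R *: x = map_mx intr z ->
  in_dilate z s.
Proof.
move=> Px xz.
have ge0 (a : 'I_m -> int) : (forall i j : 'I_m, (i < j)%N -> e i j -> a j <= a i) ->
    0 <= pairing a z.
  move=> a_ge; rewrite -(ler0z R) (pairing_dilate a xz) mulr_ge0 //.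
  by apply: polytope_pairing_ge0 => // i j ij eij; rewrite ler_int a_ge.
have single (c : int) l : pairing (fun i => if i == l then c else 0) z = c * z 0 l.
  rewrite /pairing (bigD1 l) //= eqxx big1 ?addr0 // => i il.
  by rewrite (negPf il) mul0r.
apply/in_dilateP; split.
- move=> l; apply/andP; split.
    have [//|nE] := boolP (Et l); rewrite /= -oppr_ge0 -mulN1r -single; apply: ge0 => i j ij eij.
    have /andP[Ei _] := e_types ij eij.
    have -> : (i == l) = false by apply: contraNF nE => /eqP<-.
    by case: eqP.
  have [//|nN] := boolP (Nt l); rewrite /= -[z 0 l]mul1r -single; apply: ge0 => i j ij eij.
  have /andP[_ Nj] := e_types ij eij.
  have -> : (j == l) = false by apply: contraNF nN => /eqP<-.
  by case: eqP.
- move=> k; rewrite big_mkcond.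
  have -> : \sum_(l < m) (if (l < k)%N then z 0 l else 0) =
      pairing (fun l : 'I_m => if (l < k)%N then 1 else 0) z.
    by apply: eq_bigr => l _; case: ifP; rewrite ?mul1r ?mul0r.
  by apply: ge0 => i j ij _ /=; case: (ltnP j k) => jk; [rewrite (ltn_trans ij jk)|case: ifP].
- have sumE (c : int) : c * \sum_(l < m) z 0 l = pairing (fun=> c) z by rewrite mulr_sumr.
  apply/eqP; rewrite eq_le -oppr_ge0 -mulN1r sumE -[X in _ && (_ <= X)]mul1r sumE.
  by rewrite !ge0.
pose a l : int := if 0 < z 0 l then 1 else 0.
have -> : \sum_(i < m) Num.max (z 0 i) 0 = pairing a z.
  by apply: eq_bigr => i _; rewrite /a; case: (ltrP 0 (z 0 i)) => _; rewrite ?mul1r ?mul0r.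
rewrite -(ler_int R) (pairing_dilate a xz) -[leRHS]mulr1 ler_wpM2l //.
apply: polytope_pairing_le1 => // i j.
by rewrite -intrB -[1]/(1%:~R) ler_int /a; do 2!case: ifP.
Qed.

(* Subtract [e_i - e_j] with [j] the first negative coordinate. *)
Lemma feasible_split z s : in_dilate z s -> z != 0 ->
  exists i j : 'I_m, [/\ (i < j)%N, Et i, Nt j, (0 < s)%N &
    in_dilate (z - (delta_mx 0 i - delta_mx 0 j)) s.-1].
Proof.
move=> /in_dilateP[sg tr sm mx] z0.
have [j0 zj0] : exists j, z 0 j < 0.
  apply/existsP; apply: contraNT z0 => /existsPn z_ge.
  have zge l : 0 <= z 0 l by rewrite leNgt.
  apply/eqP/rowP => l; rewrite mxE; apply/eqP.
  move: sm => /eqP; rewrite psumr_eq0 // => /allP/(_ l); rewrite mem_index_enum => /(_ isT).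
  by [].
have [j zj jmin] : exists2 j, z 0 j < 0 & forall l : 'I_m, (l < j)%N -> 0 <= z 0 l.
  case: (arg_minnP (P := fun j => z 0 j < 0) (fun j => val j) zj0) => j zj jmin.
  exists j => // l lj; rewrite leNgt; apply/negP => /jmin /=; rewrite leqNgt lj //.
have [i ij zi] : exists2 i : 'I_m, (i < j)%N & 0 < z 0 i.
  have := tr j.+1; rewrite (bigD1 j) //= => pos.
  have : 0 < \sum_(l < m | (l < j.+1)%N && (l != j)) z 0 l by lra.
  case: (pickP (fun l : 'I_m => (l < j)%N && (0 < z 0 l))) => [l /andP[lj zl]|no].
    by exists l.
  suff -> : \sum_(l < m | (l < j.+1)%N && (l != j)) z 0 l = 0 by rewrite ltxx.
  apply: big1 => k /andP[]; rewrite ltnS leq_eqVlt => /orP[/eqP/val_inj->|kj _].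
    by rewrite eqxx.
  by have := no k; rewrite kj /=; have := jmin k kj; rewrite le_eqVlt => /orP[/eqP|->].
have ij' : i != j by rewrite -val_eqE /= ltn_eqF.
have Ei : Et i by have /andP[/orP[//|]] := sg i; rewrite leNgt zi.
have Nj : Nt j by have /andP[_ /orP[//|]] := sg j; rewrite leNgt zj.
pose z' := z - (delta_mx 0 i - delta_mx 0 j).
have z'E l : z' 0 l = z 0 l - ((l == i)%:Z - (l == j)%:Z).
  by rewrite !mxE /=; case: (l == i); case: (l == j).
have dsum (Q : pred 'I_m) k : \sum_(l < m | Q l) (l == k)%:Z = (Q k)%:Z.
  rewrite big_mkcond (bigD1 k) //= eqxx big1 ?addr0; first by case: (Q k).
  by move=> l /negPf->; case: (Q l).
have sumE (Q : pred 'I_m) : \sum_(l < m | Q l) z' 0 l =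
    \sum_(l < m | Q l) z 0 l - ((Q i)%:Z - (Q j)%:Z).
  by under eq_bigr do rewrite z'E; rewrite sumrB sumrB !dsum.
have s0 : (0 < s)%N.
  rewrite -ltz_nat; apply: lt_le_trans mx; rewrite (bigD1 i) //= max_l ?ltW //.
  by apply: ltr_wpDr => //; apply: sumr_ge0 => l _; rewrite le_max lexx orbT.
exists i, j; split=> //; rewrite -/z'; apply/in_dilateP; split.
- move=> l; have := sg l; rewrite z'E.
  have [->|li] := eqVneq l i; first by rewrite (negPf ij') Ei /= => /orP[->|]//; lia.
  have [->|lj] := eqVneq l j; last by rewrite subrr subr0.
  by rewrite Nj /= !andbT => _; apply/orP; right; lia.
- move=> k; rewrite sumE; have := tr k.
  case: (ltnP j k) => [jk|kj]; first by rewrite (ltn_trans ij jk) subrr subr0.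
  (* For [i < k <= j] the partial sum loses 1. It can afford this: all coordinates before [j] are
     nonnegative and the one at [i] is at least 1. *)
  case: (ltnP i k) => [ik|_]; last by rewrite subrr subr0.
  rewrite (bigD1 i) //= => _.
  have : 0 <= \sum_(l < m | (l < k)%N && (l != i)) z 0 l.
    by apply: sumr_ge0 => l /andP[lk _]; apply: jmin; apply: leq_trans kj.
  by move=> S0; rewrite subr0 addrAC addr_ge0 // subr_ge0; move: zi; lia.
- by rewrite (sumE predT) /= subrr subr0.
have maxE l : Num.max (z' 0 l) 0 = Num.max (z 0 l) 0 - (l == i)%:Z.
  rewrite z'E; have [->|li] := eqVneq l i; first by rewrite (negPf ij') /= subr0 !max_l; lia.
  have [->|lj] := eqVneq l j; last by rewrite !subr0.
  by rewrite subr0 !max_r; lia.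
under eq_bigr do rewrite maxE; rewrite sumrB dsum.
by rewrite lerBlDr; apply: le_trans mx _; lia.
Qed.

Definition vertex (x : 'rV[R]_m) : Prop :=
  x = 0 \/ root_cone e x /\ exists i j : 'I_m, (i < j)%N /\ x = root_vector R i j.

Lemma feasible_sum z s : in_dilate z s ->
  exists p : seq 'rV[R]_m, [/\ size p = s, (forall t, (t < s)%N -> vertex (nth 0 p t))
    & map_mx intr z = \sum_(t < s) nth 0 p t].
Proof.
elim: s z => [|s IH] z zs.
  have [->|/(feasible_split zs)[i [j []]]//] := eqVneq z 0.
  by exists [::]; split=> //; rewrite big_ord0; apply/rowP => l; rewrite !mxE.
have [->|/(feasible_split zs)[i [j [ij Ei Nj _ /IH[p [sp pV zE]]]]]] := eqVneq z 0.
  (* Once [z] is exhausted, the remaining summands are the vertex 0; this accounts for a positive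
     part smaller than [s]. *)
  exists (nseq s.+1 0); split; first by rewrite size_nseq.
    by move=> t ts; rewrite nth_nseq ts; left.
  rewrite big1; first by apply/rowP => l; rewrite !mxE.
  by move=> t _; rewrite nth_nseq ltn_ord.
exists (root_vector R i j :: p); split; first by rewrite /= sp.
  case=> [_|t /pV//]; right; split; last by exists i, j.
  exact: e_paths.
rewrite big_ord_recl /= -zE; apply/rowP => l; rewrite !mxE /=.
by rewrite !rmorphB /= !rmorph_nat; ring.
Qed.

Lemma feasible_dilate z s : in_dilate z s ->
  exists2 x, root_polytope R e x & s%:R *: x = map_mx intr z.
Proof.
case: s => [|s] zs.
  have [->|/(feasible_split zs)[i [j []]]//] := eqVneq z 0.
  exists 0; last by apply/rowP => l; rewrite !mxE mulr0.
  exists 1%N, (fun=> 0), (fun=> 1); split=> //; first by move=> _; left.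
    by rewrite big_ord1.
  by rewrite big_ord1 scaler0.
have [p [sp pV zE]] := feasible_sum zs.
have s0 : s.+1%:R != 0 :> R by rewrite pnatr_eq0.
exists (s.+1%:R^-1 *: map_mx intr z); last by rewrite scalerA divff // scale1r.
exists s.+1, (fun t => nth 0 p t), (fun=> s.+1%:R^-1); split.
- by move=> t; apply: pV.
- by move=> _; rewrite invr_ge0.
- by rewrite sumr_const card_ord -(mulr_natl s.+1%:R^-1) divff.
by rewrite zE scaler_sumr.
Qed.

Lemma ehrhartE s : ehrhart (root_polytope R e) s =
  lattice_count [seq (Et i, Nt i) | i <- enum 'I_m] 0 s.
Proof.
rewrite /ehrhart -size_lattice_points; set L := lattice_points _ _ _.
pose row_of (zs : seq int) : 'rV[int]_m := \row_i nth 0 zs i.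
have szL zs : zs \in L -> size zs = m.
  rewrite mem_lattice_points => fz; rewrite -[RHS]size_enum_ord.
  move: fz; move: (enum 'I_m) (0%N : int) (s%:Z).
  by elim: zs => [|x zs IH] [|i r] h s' //= /and4P[_ _ _ /IH->].
have row_inj : {in L &, injective row_of}.
  move=> z1 z2 /szL s1 /szL s2 e12; apply: (@eq_from_nth _ 0); rewrite s1 // => i im.
  by have /rowP/(_ (Ordinal im)) := e12; rewrite !mxE.
have -> : [set z : 'rV[int]_m |
      [set s%:R *: x | x in root_polytope R e]%classic (map_mx intr z)]%classic =
    [set` [fset z in map row_of L]%fset]%classic.
  apply/seteqP; split=> z /=.
    move=> [x Px xz]; have := dilate_feasible Px xz; rewrite /in_dilate => fz.
    rewrite inE; apply/mapP; exists [seq z 0 i | i <- enum 'I_m].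
      by rewrite mem_lattice_points.
    apply/rowP => i; rewrite mxE (nth_map i) ?size_enum_ord //.
    by rewrite nth_ord_enum.
  rewrite inE => /mapP[zs zsL ->].
  have [|x Px xz] := @feasible_dilate (row_of zs) s; last by exists x.
  rewrite /in_dilate; have -> : [seq row_of zs 0 i | i <- enum 'I_m] = zs.
    apply: (@eq_from_nth _ 0); rewrite size_map size_enum_ord ?szL // => t tm.
    by rewrite (nth_map (Ordinal tm)) ?size_enum_ord // mxE nth_enum_ord.
  by rewrite -mem_lattice_points.
rewrite set_fsetK card_fseq undup_id ?size_map //.
by rewrite map_inj_in_uniq // lattice_points_uniq.
Qed.
End RootPolytope.

(** * Dimension of the root polytope *)

Section Dimension.
Variables (R : realType) (m : nat) (e : rel 'I_m.+1) (Et Nt : pred 'I_m.+1).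
Hypothesis e_paths : forall i j : 'I_m.+1, (i < j)%N -> Et i -> Nt j ->
  root_cone e (root_vector R i j).
Hypothesis types_some : forall l, Et l || Nt l.
Hypothesis type_first : (0 < m)%N -> Et ord0.
Hypothesis type_last : Nt ord_max.

Lemma vertex_polytope (x : 'rV[R]_m.+1) : vertex e x -> root_polytope R e x.
Proof.
move=> vx; exists 1%N, (fun=> x), (fun=> 1); split=> //; first by rewrite big_ord1.
by rewrite big_ord1 scale1r.
Qed.

Lemma polytope_total (x : 'rV[R]_m.+1) : root_polytope R e x -> \sum_l x 0 l = 0.
Proof.
move=> Px; have sumE (c : R) : c * \sum_l x 0 l = pairing (fun=> c) x by rewrite mulr_sumr.
apply/eqP; rewrite eq_le -oppr_ge0 -mulN1r sumE -[X in _ && (_ <= X)]mul1r sumE.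
by rewrite !(polytope_pairing_ge0 _ Px).
Qed.

Lemma affine_dim_le : (affine_dim (root_polytope R e) <= m)%N.
Proof.
apply/bigmax_leqP => k /asboolP[p0 [p [Pp0 Pp fr]]].
rewrite leqNgt; apply/negP => lt_mk.
(* The maximum ranges up to [m.+1], so this is the only value to exclude: that many independent
   differences would span the whole space, whereas all of them have coordinate sum 0. *)
have k_m : k = m.+1 :> nat by have := ltn_ord k; lia.
set X := [seq q - p0 | q <- p] in fr.
have szX : size X = m.+1 by rewrite size_map size_tuple.
have full : <<X>>%VS = fullv.
  apply/eqP; rewrite eqEdim subvf dimvf dim_matrix mul1r.
  by move: fr; rewrite /free => /eqP->; rewrite szX leqnn.
have tot (v : 'rV[R]_m.+1) : v \in <<X>>%VS -> \sum_l v 0 l = 0.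
  move=> vX; rewrite (@coord_span _ _ _ (in_tuple X) v) //.
  under eq_bigr => l _ do rewrite summxE.
  rewrite exchange_big big1 // => i _.
  under eq_bigr => l _ do rewrite mxE.
  have ik : (i < k)%N by apply: leq_trans (ltn_ord i) _; rewrite size_map size_tuple.
  rewrite -mulr_sumr (nth_map p0) ?size_tuple // -(tnth_nth p0 p (Ordinal ik)).
  under eq_bigr => l _ do rewrite !mxE.
  by rewrite sumrB (polytope_total Pp0) (polytope_total (Pp _)) subr0 mulr0.
have := tot (delta_mx 0 ord0); rewrite full memvf => /(_ isT).
rewrite (bigD1 ord0) //= mxE !eqxx big1 ?addr0; first by move/eqP; rewrite oner_eq0.
by move=> l l0; rewrite mxE (negPf l0) andbF.
Qed.

Lemma affine_dimE : affine_dim (root_polytope R e) = m.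
Proof.
apply/eqP; rewrite eqn_leq affine_dim_le /=.
have lt_m : (m < m.+2)%N by [].
apply: (@leq_bigmax_cond _ _ (fun k : 'I_m.+2 => k : nat) (Ordinal lt_m)).
apply/asboolP => /=.
(* An E label is paired with the last label, any other label with the first. A coordinate strictly
   between the first and the last is nonzero in its own vector only, which kills all coefficients
   but that of label 0. *)
pose v (l : 'I_m) : 'rV[R]_m.+1 :=
  let l' := widen_ord (leqnSn m) l in
  if Et l' then root_vector R l' ord_max else root_vector R ord0 l'.
exists 0, [tuple v l | l < m]; split.
- by apply: vertex_polytope; left.
- move=> l; rewrite tnth_mktuple; apply: vertex_polytope; right; rewrite /v /=.
  set l' := widen_ord _ l; have l'E : l' = l :> nat by [].
  have m0 : (0 < m)%N by apply: leq_ltn_trans (ltn_ord l).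
  case: ifP => El.
    by split; [apply: e_paths|exists l', ord_max] => //=; rewrite l'E.
  have l0 : (0 < l')%N.
    rewrite lt0n; apply: contraFN El => /eqP l0.
    by rewrite (_ : l' = ord0) ?type_first //; apply: val_inj.
  have Nl : Nt l' by have := types_some l'; rewrite El.
  by split; [apply: e_paths => //; apply: type_first|exists ord0, l'].
have -> : [seq q - 0 | q <- [tuple v l | l < m]] = [tuple v l | l < m] :> seq _.
  by rewrite -[RHS]map_id; apply: eq_map => q; rewrite subr0.
apply/freeP => c; under eq_bigr => l _ do rewrite -tnth_nth tnth_mktuple.
move=> /rowP sum0.
have coef (l : 'I_m) (l' : 'I_m.+1) : (l' < m)%N -> (0 < l')%N ->
    v l 0 l' = if l == l' :> nat then (if Et l' then 1 else -1) else 0.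
  move=> l'm l'0; rewrite /v; set k := widen_ord _ l.
  have kE : (k == l') = (l == l' :> nat) by [].
  have lastE : (l' == ord_max) = false by rewrite -val_eqE /= ltn_eqF.
  have firstE : (l' == ord0) = false by rewrite -val_eqE /= gtn_eqF.
  case: ifP => Ek; rewrite !mxE /= [l' == k]eq_sym kE ?lastE ?firstE.
    case: eqP => [kl|_]; rewrite ?subr0 //.
    by move: Ek; rewrite (_ : k = l') ?Ek => [->|]; last exact: val_inj.
  case: eqP => [kl|_]; rewrite ?subrr ?sub0r ?oppr0 //.
  by rewrite (_ : l' = k) ?Ek //; apply: val_inj.
have c0 (l : 'I_m) : (0 < l)%N -> c l = 0.
  move=> l0; have := sum0 (widen_ord (leqnSn m) l).
  rewrite summxE mxE (bigD1 l) //= mxE coef //= eqxx.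
  rewrite big1 ?addr0.
    by move/eqP; rewrite mulf_eq0; case: ifP; rewrite ?oppr_eq0 oner_eq0 orbF => _ /eqP.
  by move=> k kl; rewrite mxE coef //= val_eqE (negPf kl) mulr0.
move=> l; case: (posnP l) => [l0|]; last exact: c0.
have m0 : (0 < m)%N by apply: leq_ltn_trans (ltn_ord l).
have := sum0 ord0; rewrite summxE mxE (bigD1 l) //= mxE big1 ?addr0; last first.
  move=> k kl; rewrite c0 ?scale0r ?mxE //; rewrite lt0n -l0; exact: kl.
rewrite /v (_ : widen_ord _ l = ord0); last exact: val_inj.
rewrite type_first // !mxE !eqxx /=.
have -> : (ord0 == ord_max :> 'I_m.+1) = false by rewrite -val_eqE /= ltn_eqF.
by rewrite subr0 mulr1.
Qed.
End Dimension.

(** * The region, its boundary and the labels *)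

Local Open Scope nat_scope.

(** The rows and columns of the diagram are intervals starting at 1. Pushing such an interval to the
    border therefore shifts it by one, whence the successor of [r]. *)
Lemma card_initial n (A : {set 'I_n.+1}) r :
    (forall a : 'I_n.+1, a \in A -> 0 < a) ->
    (forall a b : 'I_n.+1, 0 < b -> b < a -> a \in A -> b \in A) ->
  r < n -> (r < #|A|) = (inord r.+1 \in A).
Proof.
move=> A0 Ainit lt_rn; have rE : @inord n r.+1 = r.+1 :> nat by rewrite inordK.
have cardE k : k <= n -> #|[set l : 'I_n.+1 | l < k.+1] :\ ord0| = k.
  move=> kn; have := cardsD1 (ord0 : 'I_n.+1) [set l : 'I_n.+1 | l < k.+1].
  by rewrite card_ord_lt // inE /= => -[].
have [rA|rA] := boolP (_ \in A).
  rewrite -[r.+1](cardE r.+1) //; apply/subset_leq_card/fintype.subsetP => k.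
  rewrite !inE -val_eqE /= -lt0n => /andP[k0]; rewrite ltnS leq_eqVlt => /orP[/eqP kr|kr].
    by rewrite (_ : k = inord r.+1) //; apply: val_inj; rewrite /= rE.
  by apply: Ainit rA; rewrite ?rE.
apply/negbTE; rewrite -leqNgt -[X in _ <= X](cardE r) ?(ltnW lt_rn) //.
apply/subset_leq_card/fintype.subsetP => k kA; rewrite !inE -val_eqE /= -lt0n A0 //=.
rewrite ltnNge; apply/negP => lt_rk; case/negP: rA.
move: lt_rk; rewrite leq_eqVlt => /orP[/eqP kr|kr]; last by apply: Ainit kA; rewrite rE.
by rewrite (_ : inord r.+1 = k) //; apply: val_inj; rewrite /= rE.
Qed.

Section Region.
Variables (n : nat) (pi : 'S_n.+1).
Hypothesis pi_dom : one_dominant pi.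
Local Notation N := n.+1.
Let q : 'S_N := pi^-1%g.
Local Notation rl := (row_len pi).

Lemma diagramE (x : box N) : (x \in diagram pi) = (x.2 < q x.1) && (x.1 < pi x.2).
Proof.
case: x => a c /=; apply/imset2P/andP => [[i j _ /[!inE] /andP[ij ltp] [-> ->]]|[cq ap]].
  by rewrite /q permK; case/andP: ltp.
by exists c (q a); rewrite ?inE /q ?permKV ?cq.
Qed.

Lemma row_len0 : rl 0 = 0.
Proof.
apply/eqP; rewrite cards_eq0; apply/eqP/setP => k; rewrite !inE.
have -> : inord 0 = ord0 :> 'I_N by apply: val_inj; rewrite /= inordK.
by rewrite inv_pi0 // andbF.
Qed.

Lemma row_len_anti a b : 0 < a -> a <= b -> rl b <= rl a.
Proof.
move=> a0 /subnKC <-; elim: (b - a) => [|d IH]; first by rewrite addn0.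
by rewrite addnS; apply: leq_trans IH; apply: sorted_row_len => //; lia.
Qed.

Lemma row_len_le a : rl a <= n - a.
Proof.
have [a0|a0] := posnP a; first by rewrite a0 row_len0.
have [le_an|/ltnW lt_na] := leqP a n; last by rewrite row_len_gt.
by rewrite row_lenE ?a0 // (leq_trans (count_size _ _)) // size_map size_iota.
Qed.

Lemma card_diagram_row (r : 'I_N) : #|[set x in diagram pi | x.1 == r]| = rl r.
Proof.
rewrite /row_len inord_val -(card_imset _ (f := fun k => (r, q k))); last first.
  by move=> k l [/perm_inj].
apply: eq_card => -[a c]; rewrite inE diagramE /=; apply/idP/imsetP => [|[k]].
  by case/andP=> /andP[cq ap] /eqP ar; subst a; exists (pi c); rewrite /q ?permK // inE ap permK.
by rewrite inE => /andP[rk kr] [-> ->]; rewrite eqxx andbT /q permKV rk kr.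
Qed.

Lemma mem_diagram (a c : 'I_N) : ((a, c) \in diagram pi) = (0 < c <= rl a).
Proof.
pose A := [set c : 'I_N | (a, c) \in diagram pi].
have cardA : #|A| = rl a.
  rewrite -card_diagram_row -(card_imset _ (f := fun c => (a, c))); last by move=> ? ? [].
  apply: eq_card => -[b d]; rewrite inE /=.
  apply/imsetP/andP => [[d' /[!inE] d'A [-> ->]]|[bd /eqP ba]].
    by rewrite eqxx.
  by subst b; exists d; rewrite ?inE.
have A0 (d : 'I_N) : d \in A -> 0 < d.
  rewrite inE diagramE /= => /andP[_ ap]; rewrite lt0n; apply: contraTneq ap => d0.
  by rewrite (_ : d = ord0) ?(proj1 pi_dom) //; apply: val_inj.
have Ainit (d d' : 'I_N) : 0 < d' -> d' < d -> d \in A -> d' \in A.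
  move=> d'0 d'd; rewrite !inE !diagramE /= => /andP[dq ap].
  rewrite (ltn_trans d'd dq) /= ltnNge leq_eqVlt negb_or; apply/andP; split.
    apply: contraL (ltn_trans d'd dq) => /eqP/val_inj <-; by rewrite /q permK ltnn.
  apply/negP => pa.
  by have := proj2 pi_dom d' d (q a) d'0 d'd dq; rewrite permKV; apply.
have -> : ((a, c) \in diagram pi) = (c \in A) by rewrite inE.
have [c0|c0] := posnP c.
  by apply/negP => /A0; rewrite c0.
rewrite -cardA -[X in _ <= X]/(#|A|) -(prednK c0) (card_initial A0) //; last first.
  by have := ltn_ord c; lia.
by rewrite prednK // inord_val.
Qed.

Lemma mem_bottom (p : box N) : (p \in bottom_dream pi) = (p.2 < rl p.1).
Proof. by rewrite inE card_diagram_row. Qed.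

Lemma mem_top (p : box N) : (p \in top_dream pi) = (0 < p.2 <= rl p.1.+1).
Proof.
case: p => r c; rewrite inE /=; set C := [set _ in _ | _].
pose A := [set a : 'I_N | 0 < c <= rl a].
have -> : #|C| = #|A|.
  rewrite -[RHS](card_imset _ (f := fun a => (a, c))); last by move=> ? ? [].
  apply: eq_card => -[a d]; rewrite inE mem_diagram /=.
  apply/andP/imsetP => [[cd /eqP dc]|[a' /[!inE] ? [-> ->]]].
    by subst d; exists a; rewrite ?inE.
  by rewrite eqxx.
have A0 (a : 'I_N) : a \in A -> 0 < a.
  rewrite inE => h; rewrite lt0n; apply: contraTneq h => ->; rewrite row_len0; lia.
have Ainit (a b : 'I_N) : 0 < b -> b < a -> a \in A -> b \in A.
  move=> b0 ba; rewrite !inE => /andP[-> /=]; move/leq_trans; apply.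
  by apply: row_len_anti => //; apply: ltnW.
have [lt_rn|le_nr] := ltnP r n.
  by rewrite (card_initial A0) // inE inordK.
rewrite row_len_gt; last exact: leqW.
have -> : (0 < c <= 0) = false by lia.
apply/negbTE; rewrite -leqNgt; apply: leq_trans le_nr.
apply: (@leq_trans #|[set: 'I_N] :\ ord0|).
  by apply/subset_leq_card/fintype.subsetP => a /A0; rewrite !inE -val_eqE /= lt0n => ->.
have := cardsD1 (ord0 : 'I_N) [set: 'I_N]; rewrite cardsT card_ord inE add1n => e.
by rewrite -ltnS -[X in X <= _]e.
Qed.

(** In row [r > 0] the bottom dream fills the columns below [rl r] and the top dream the columns
    from 1 to [rl r.+1]. The union exceeds [rl r] only for two equal nonempty rows, and then by one
    box. Row 0 consists of the corner box and crosses of the top dream. *)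
Definition region_len r :=
  if r == 0 then (rl 1).+1
  else if rl r.+1 < rl r then rl r
  else if 0 < rl r then (rl r).+1 else 0.
Local Notation rho := region_len.

Lemma mem_region (p : box N) : (p \in region pi) = (p.2 < rho p.1).
Proof.
case: p => r c; rewrite /region /core_region !in_setU mem_bottom mem_top !inE /= /region_len.
case: eqP => [->|r0]; first by rewrite row_len0; lia.
have := @row_len_anti r r.+1; do ?case: ifP; lia.
Qed.

Lemma region_len_anti r : rho r.+1 <= rho r.
Proof.
rewrite /region_len /=; case: eqP => [->|r0].
  have := @row_len_anti 1 2; do ?case: ifP; lia.
have := @row_len_anti r r.+1; have := @row_len_anti r.+1 r.+2; do ?case: ifP; lia.
Qed.

Lemma region_len_le r : rho r <= N.
Proof.
rewrite /region_len; have := row_len_le r; have := row_len_le 1.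
case: eqP => [_|r0]; first by lia.
by do ?case: ifP; lia.
Qed.

Lemma region_len_gt0 r : r < N -> 0 < rl 1 -> (0 < rho r) = (0 < rl r) || (r == 0).
Proof. by rewrite /region_len; case: eqP => //= r0; do ?case: ifP; lia. Qed.

Lemma region_len_end r : n <= r -> 0 < r -> rho r = 0.
Proof.
move=> nr r0; rewrite /region_len gtn_eqF // !row_len_gt //; exact: leqW.
Qed.

Lemma lower_edge (p : box N) : on_lower_edge pi p = (rho p.1.+1 <= p.2 < rho p.1).
Proof.
rewrite /on_lower_edge mem_region andbC; congr (_ && _).
rewrite [RHS]leqNgt; congr negb; apply/existsP/idP => [[s /andP[]]|lt_c].
  by rewrite mem_region => ? /andP[/eqP<- /eqP<-].
have r1 : p.1.+1 < N.
  rewrite ltnNge; apply/negP => le; move: lt_c; rewrite region_len_end //; exact: ltnW.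
by exists (inord p.1.+1, p.2); rewrite mem_region /= inordK // lt_c !eqxx.
Qed.

Lemma right_edge (p : box N) : on_right_edge pi p = (p.2.+1 == rho p.1).
Proof.
rewrite /on_right_edge mem_region.
case: (ltnP p.2 (rho p.1)) => [lt_c|le_c] /=; last by apply/esym/negbTE; lia.
rewrite eqn_leq lt_c /= [RHS]leqNgt; congr negb; apply/existsP/idP => [[s /andP[]]|lt_c'].
  by rewrite mem_region => ? /andP[/eqP<- /eqP<-].
have c1 : p.2.+1 < N by apply: leq_trans lt_c' (region_len_le _).
by exists (p.1, inord p.2.+1); rewrite mem_region /= inordK // lt_c' !eqxx.
Qed.

Lemma mem_boundary (s : step n.+1) : (s \in boundary pi) =
  (if isN s then s.2.2.+1 == rho s.2.1 else rho s.2.1.+1 <= s.2.2 < rho s.2.1).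
Proof.
case: s => b [r c] /=; apply/flattenP/idP => [[_ /mapP[r' _ ->]]|].
  rewrite mem_cat => /orP[] /mapP[c']; rewrite mem_filter => /andP[edge _] [-> -> ->] /=.
    by rewrite -(lower_edge (r', c')).
  by rewrite -(right_edge (r', c')).
move=> edge; eexists; first by apply/mapP; exists r; [rewrite mem_rev mem_enum|reflexivity].
rewrite mem_cat; case: b edge => edge; apply/orP; [right|left]; apply/mapP; exists c => //.
  by rewrite mem_filter right_edge edge mem_enum.
by rewrite mem_filter lower_edge edge mem_enum.
Qed.
End Region.

Lemma filter_iota_between a b m : a <= b -> b <= m ->
  [seq x <- iota 0 m | a <= x < b] = iota a (b - a).
Proof.
move=> ab bm; have -> : m = a + ((b - a) + (m - b)) by lia.
rewrite !iotaD !filter_cat add0n subnKC //.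
rewrite (_ : [seq x <- iota 0 a | _] = [::]); last first.
  by apply/eqP; rewrite -[_ == _]negbK -has_filter; apply/hasPn => x; rewrite mem_iota; lia.
rewrite (_ : [seq x <- iota b _ | _] = [::]); last first.
  by apply/eqP; rewrite -[_ == _]negbK -has_filter; apply/hasPn => x; rewrite mem_iota; lia.
rewrite cats0 /=; apply/all_filterP/allP => x; rewrite mem_iota; lia.
Qed.

Section Labels.
Variables (n : nat) (pi : 'S_n.+1).
Hypothesis pi_dom : one_dominant pi.
Local Notation N := n.+1.
Local Notation rl := (row_len pi).
Local Notation rho := (region_len pi).

Definition nat_step (s : step N) : bool * (nat * nat) := (s.1, (s.2.1 : nat, s.2.2 : nat)).

Definition boundary_row r : seq (bool * (nat * nat)) :=
  [seq (false, (r, c)) | c <- iota (rho r.+1) (rho r - rho r.+1)] ++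
  (if 0 < rho r then [:: (true, (r, (rho r).-1))] else [::]).

Lemma boundary_rows :
  map nat_step (boundary pi) = flatten [seq boundary_row r | r <- rev (iota 0 N)].
Proof.
rewrite map_flatten -val_enum_ord -map_rev -!map_comp; congr flatten.
apply: eq_map => r /=; rewrite map_cat -!map_comp; congr (_ ++ _).
  rewrite -(filter_iota_between (region_len_anti pi_dom r) (region_len_le pi_dom r)).
  rewrite -val_enum_ord filter_map -map_comp; congr map.
  by apply: eq_filter => c; rewrite /= (lower_edge pi_dom (r, c)).
transitivity [seq (true, (r : nat, c)) |
    c <- [seq val c | c <- enum 'I_N & on_right_edge pi (r, c)]].
  by rewrite -map_comp.
rewrite (eq_filter (a2 := preim val (fun c => c.+1 == rho r))); last first.
  by move=> c; rewrite /= (right_edge pi_dom (r, c)).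
rewrite -filter_map val_enum_ord.
have [r0|r0] := posnP (rho r).
  by rewrite r0 (eq_filter (a2 := pred0)) ?filter_pred0.
rewrite (eq_filter (a2 := fun c => (rho r).-1 <= c < rho r)); last by move=> c /=; lia.
rewrite filter_iota_between ?leq_pred ?(region_len_le pi_dom) //.
by have -> : rho r - (rho r).-1 = 1 by lia.
Qed.

(* [row_step a] is the number of labels used in row [a], and [row_label r] is the
   label of the N step of row [r], unless [pi] is the identity. *)
Definition row_step a := if a == 0 then 1 else if 0 < rl a then maxn (rl a - rl a.+1) 1 else 0.
Definition row_label r := (\sum_(r <= a < N) row_step a).+1.
Local Notation Lam := row_label.

Lemma row_labelS r : r < N -> Lam r = row_step r + Lam r.+1.
Proof. by move=> lt_rN; rewrite /row_label big_ltn // addnS. Qed.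

Lemma row_label_anti r r' : r <= r' -> Lam r' <= Lam r.
Proof.
move=> le_r; have [le_r'N|lt_Nr'] := leqP r' N.
  by rewrite /row_label ltnS [leqRHS](big_cat_nat (n := r')) //= leq_addl.
by rewrite {1}/row_label big_geq //; apply: ltnW.
Qed.

Lemma row_label_end r : 0 < r -> rl r = 0 -> Lam r = 1.
Proof.
move=> r0 rl0; rewrite /row_label big_nat big1 // => a /andP[ra _].
rewrite /row_step; have := row_len_anti pi_dom r0 ra; rewrite rl0 leqn0 => /eqP->.
by case: eqP => //; lia.
Qed.

(** Closed form of the labels. In row [r], an E step in column [rl r.+1] shares the label of the N
    step of row [r.+1], and the labels grow by one per column from there. On the boundary the
    subtraction never truncates. *)
Definition nat_label (s : bool * (nat * nat)) :=
  if s.1 then Lam s.2.1 else Lam s.2.1.+1 + s.2.2 - rl s.2.1.+1.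

Definition in_bottom (s : bool * (nat * nat)) := s.2.2 < rl s.2.1.

(** The recursion of [labels_from] as a condition on consecutive steps, so that the closed form is
    checked along a [path]. *)
Definition label_step (s s' : bool * (nat * nat)) :=
  if s'.1 || in_bottom s' && ~~ (s.1 && in_bottom s) then nat_label s' == (nat_label s).+1
  else s.1 && (nat_label s' == nat_label s).

Lemma in_A_nat s s' : in_A pi (Some s) s' =
  (nat_step s').1 || in_bottom (nat_step s') && ~~ ((nat_step s).1 && in_bottom (nat_step s)).
Proof. by rewrite /in_A /isN /bounds !mem_bottom. Qed.

Lemma labels_from_path s ss : path label_step (nat_step s) (map nat_step ss) ->
  labels_from pi (nat_label (nat_step s)) (Some s) ss = map (nat_label \o nat_step) ss.
Proof.
elim: ss s => //= s' ss IH s /andP[st pth]; rewrite in_A_nat.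
move: st; rewrite /label_step; case: ifP => _ => [/eqP lab|/andP[Ns /eqP lab]].
  by rewrite -lab IH.
by rewrite /isN -[s.1]/((nat_step s).1) Ns -lab IH.
Qed.

Section NonTrivial.
Hypothesis rl1 : 0 < rl 1.

Lemma label_step_EE r c : rho r.+1 <= c -> c.+1 < rho r ->
  label_step (false, (r, c)) (false, (r, c.+1)).
Proof.
move=> le_c lt_c; have cr : c.+1 < rl r.
  move: le_c lt_c; rewrite /region_len /=; case: eqP => [->|r0]; first by do ?case: ifP; lia.
  have := row_len_anti pi_dom (a := r) (b := r.+1).
  by do ?case: ifP; lia.
have rc : rl r.+1 <= c by move: le_c; rewrite /region_len /=; do ?case: ifP; lia.
by rewrite /label_step /in_bottom /= cr /nat_label /=; apply/eqP; lia.
Qed.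

Lemma row_label_region r : r < N -> 0 < rho r -> Lam r + rl r.+1 = Lam r.+1 + rho r.
Proof.
move=> lt_rN; rewrite row_labelS // /row_step /region_len; case: eqP => [->|r0]; first by lia.
have := row_len_anti pi_dom (a := r) (b := r.+1); do ?case: ifP; lia.
Qed.

Lemma label_step_EN r : r < N -> 0 < rho r ->
  label_step (false, (r, (rho r).-1)) (true, (r, (rho r).-1)).
Proof.
move=> lt_rN r0; rewrite /label_step /nat_label /=.
have := row_label_region lt_rN r0; have : 0 < Lam r by [].
by move=> ? ?; apply/eqP; lia.
Qed.

Lemma label_step_NE r : rho r.+1 < rho r -> 0 < rho r.+1 ->
  label_step (true, (r.+1, (rho r.+1).-1)) (false, (r, rho r.+1)).
Proof.
rewrite /label_step /in_bottom /nat_label /=.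
have := row_len_anti pi_dom (a := r.+1) (b := r.+2).
have := row_len_anti pi_dom (a := r) (b := r.+1).
rewrite /region_len /=; case: (eqVneq r 0) => [->|r0] /=; do ?case: ifP; rewrite ?andFb; lia.
Qed.

Lemma region_len_gt r : 0 < rl r.+1 -> rl r.+1 < rho r.
Proof.
rewrite /region_len; case: eqP => [->|r0]; first by lia.
by have := row_len_anti pi_dom (a := r) (b := r.+1); do ?case: ifP; lia.
Qed.

Lemma label_step_NN r : r < N -> rho r.+1 = rho r -> 0 < rho r.+1 ->
  label_step (true, (r.+1, (rho r.+1).-1)) (true, (r, (rho r).-1)).
Proof.
move=> lt_rN eq_rho r1; rewrite /label_step /nat_label /=; apply/eqP.
have rl0 : 0 < rl r.+1 by move: r1; rewrite /region_len /=; do ?case: ifP; lia.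
have := row_label_region lt_rN; rewrite -eq_rho => /(_ r1).
have := region_len_gt rl0; rewrite -eq_rho /region_len /=.
have := row_len_anti pi_dom (a := r.+1) (b := r.+2); do ?case: ifP; lia.
Qed.

Lemma path_row r c d : r < N -> rho r.+1 <= c -> c + d.+1 = rho r ->
  path label_step (false, (r, c))
    ([seq (false, (r, c')) | c' <- iota c.+1 d] ++ [:: (true, (r, (rho r).-1))]).
Proof.
move=> lt_rN; elim: d c => [|d IH] c le_c cd.
  have <- : (rho r).-1 = c by lia.
  by rewrite /= label_step_EN //; lia.
by rewrite [iota _ _]/= map_cons cat_cons /= label_step_EE ?IH //; lia.
Qed.

Definition boundary_from r := flatten [seq boundary_row a | a <- rev (iota r (N - r))].

Lemma boundary_fromS r : r < N -> boundary_from r = boundary_from r.+1 ++ boundary_row r.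
Proof.
move=> lt_rN; rewrite /boundary_from; have -> : N - r = (N - r.+1).+1 by lia.
by rewrite /= rev_cons map_rcons flatten_rcons.
Qed.

Lemma boundary_path r : r <= N -> if 0 < rho r then
    exists s0 ss, [/\ boundary_from r = s0 :: ss, path label_step s0 ss,
      last s0 ss = (true, (r, (rho r).-1)), in_bottom s0 & nat_label s0 = 1]
  else boundary_from r = [::].
Proof.
move=> le_rN; have -> : r = N - (N - r) by lia.
elim: (N - r) (leq_subr r N) => [_|k IH lt_k].
  by rewrite subn0 region_len_end // /boundary_from subnn.
have {}IH := IH (ltnW lt_k).
have rE : N - k = (N - k.+1).+1 by lia.
move: IH; rewrite rE; set t := N - k.+1 => IH.
have lt_tN : t < N by lia.
have rho_anti := region_len_anti pi_dom t.
case: ifP IH => [t1 [s0 [ss [bE pth lst b0 l0]]]|t1 bE].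
  have t0 : 0 < rho t by lia.
  rewrite t0; exists s0, (ss ++ boundary_row t); rewrite boundary_fromS // bE; split=> //.
    rewrite cat_path pth lst /boundary_row t0.
    case dE: (rho t - rho t.+1) => [|d].
      by rewrite /= label_step_NN //; lia.
    rewrite [iota _ _]/= map_cons cat_cons /= label_step_NE //=; last by lia.
    by apply: path_row => //; lia.
  by rewrite last_cat lst /boundary_row t0 last_cat.
case: ifP => t0; last first.
  by rewrite boundary_fromS // bE /boundary_row t0; have -> : rho t - rho t.+1 = 0 by lia.
have rho1 : rho t.+1 = 0 by lia.
have rl_t1 : rl t.+1 = 0 by move: rho1; rewrite /region_len /=; do ?case: ifP; lia.
have t_gt0 : 0 < t by case: (t) rl_t1 rl1 => // ->.
have rlt : rho t = rl t.
  by move: t0; rewrite /region_len gtn_eqF // rl_t1; do ?case: ifP; lia.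
exists (false, (t, 0)),
  ([seq (false, (t, c)) | c <- iota 1 (rho t).-1] ++ [:: (true, (t, (rho t).-1))]).
rewrite boundary_fromS // bE /= /boundary_row t0 rho1 subn0; split=> //.
- by rewrite -[in LHS](prednK t0).
- by apply: path_row => //; lia.
- by rewrite last_cat.
- by rewrite /in_bottom /= -rlt.
by rewrite /nat_label /= rl_t1 row_label_end.
Qed.

Lemma labelsE : labels pi = map (nat_label \o nat_step) (boundary pi).
Proof.
have := boundary_path (leq0n N); rewrite /= => -[s0 [ss [bE pth _ b0 l0]]].
have : map nat_step (boundary pi) = s0 :: ss by rewrite boundary_rows -bE /boundary_from subn0.
rewrite /labels; case: (boundary pi) => // s bd e.
have [sE ssE] : nat_step s = s0 /\ map nat_step bd = ss by case: e => <- <-.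
rewrite [LHS]/=.
have iA : in_A pi None s.
  by rewrite /in_A /bounds mem_bottom // -[_ < _]/(in_bottom (nat_step s)) sE b0 orbT.
have lab : 1 = nat_label (nat_step s) by rewrite sE l0.
by rewrite iA [in LHS]lab labels_from_path // sE ssE.
Qed.

Lemma labelE s : s \in boundary pi -> label pi s = nat_label (nat_step s).
Proof.
move=> sb; rewrite /label labelsE (nth_map s) ?index_mem //=.
by rewrite nth_index.
Qed.
End NonTrivial.
End Labels.

(** * The tree *)

Section Types.
Variables (n : nat) (pi : 'S_n.+1).
Hypothesis pi_dom : one_dominant pi.
Local Notation N := n.+1.
Local Notation rl := (row_len pi).
Local Notation rho := (region_len pi).
Local Notation Lam := (row_label pi).

(* The label [l] is that of some E step, respectively N step. *)
Definition e_label l := has (fun s => ~~ isN s && (label pi s == l)) (boundary pi).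
Definition n_label l := has (fun s => isN s && (label pi s == l)) (boundary pi).

Lemma region_len_gt_ge r r' : r <= r' -> rho r' <= rho r.
Proof.
move=> /subnKC <-; elim: (r' - r) => [|d IH]; first by rewrite addn0.
by rewrite addnS; apply: leq_trans (region_len_anti pi_dom _) IH.
Qed.

Lemma row_len_region r : rl r.+1 <= rho r.+1.
Proof. by rewrite /region_len /=; do ?case: ifP; lia. Qed.

Lemma region_len_row r : 0 < rho r -> r < N.
Proof.
move=> r0; rewrite ltnNge; apply/negP => le_Nr; move: r0.
by rewrite region_len_end //; [lia|exact: leq_ltn_trans le_Nr].
Qed.

(* Only the identity permutation is excluded. *)
Hypothesis rl1 : 0 < rl 1.

Lemma e_labelP l : reflect
  (exists r c, rho r.+1 <= c < rho r /\ l = Lam r.+1 + c - rl r.+1) (e_label l).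
Proof.
apply: (iffP hasP) => [[s sb /andP[Es /eqP <-]]|[r [c [rc ->]]]].
  exists s.2.1, s.2.2; move: (sb); rewrite mem_boundary // (negPf Es) => ->.
  by rewrite labelE // /nat_label /= -/(isN s) (negPf Es).
have r_N : r < N by apply: region_len_row; lia.
have c_N : c < N by have := region_len_le pi_dom r; lia.
have sb : (false, (inord r, inord c)) \in boundary pi.
  by rewrite mem_boundary //= !inordK.
by exists (false, (inord r, inord c)) => //; rewrite labelE // /nat_label /= !inordK.
Qed.

Lemma n_labelP l : reflect (exists2 r, 0 < rho r & l = Lam r) (n_label l).
Proof.
apply: (iffP hasP) => [[s sb /andP[Ns /eqP <-]]|[r r0 ->]].
  exists (nat_of_ord s.2.1); last by rewrite labelE // /nat_label /= -/(isN s) Ns.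
  by move: sb; rewrite mem_boundary // Ns => /eqP <-.
have r_N : r < N by apply: region_len_row.
have c_N : (rho r).-1 < N by have := region_len_le pi_dom r; lia.
have sb : (true, (inord r, inord (rho r).-1)) \in boundary pi.
  by rewrite mem_boundary //= !inordK // prednK.
by exists (true, (inord r, inord (rho r).-1)) => //; rewrite labelE // /nat_label /= inordK.
Qed.

Lemma e_label_bound r c : rho r.+1 <= c < rho r ->
  Lam r.+1 <= Lam r.+1 + c - rl r.+1 < Lam r.
Proof.
move=> rc; have r0 : 0 < rho r by lia.
have := row_label_region pi_dom rl1 (region_len_row r0) r0.
by have := row_len_region r; lia.
Qed.

Lemma row_label_lt r r' : r < r' -> 0 < rl r' -> Lam r' < Lam r.
Proof.
move=> lt_r rl'; apply: (@leq_trans (Lam r.+1).+1); first by rewrite ltnS row_label_anti.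
have r_N : r < N.
  rewrite ltnNge; apply/negP => le_Nr; move: rl'; rewrite row_len_gt //; lia.
rewrite (row_labelS _ r_N) /row_step; case: eqP => [_|r0]; first by rewrite add1n.
have -> : 0 < rl r by apply: leq_trans rl' _; apply: row_len_anti => //; lia.
by rewrite -add1n leq_add2r leq_maxr.
Qed.

(** Here the region ends with the bottom dream in row [r], so the E step following the N step, in
    row [r.-1] and column [rl r], takes over its label. *)
Lemma corner_label r : 0 < r -> rl r.+1 < rl r -> e_label (Lam r) && n_label (Lam r).
Proof.
move=> r0 lt_rl; have rhor : rho r = rl r by rewrite /region_len gtn_eqF // lt_rl.
apply/andP; split; last by apply/n_labelP; exists r => //; rewrite rhor; lia.
apply/e_labelP; exists r.-1, (rl r); rewrite prednK // rhor leqnn addnK; split=> //.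
by have := @region_len_gt _ _ pi_dom rl1 r.-1; rewrite prednK //; apply; lia.
Qed.

(** Here the region extends one box beyond the bottom dream, so E steps in row [r.-1] start at
    column [rl r + 1] at the earliest and have larger labels. *)
Lemma flat_label r : 0 < r -> 0 < rl r -> rl r.+1 = rl r -> ~~ e_label (Lam r).
Proof.
move=> r0 rlr flat; apply/e_labelP => -[r' [c [rc]]].
have := e_label_bound rc; case: (ltngtP r'.+1 r) => [lt|lt|e].
- by have := row_label_lt lt rlr; lia.
- by have := @row_label_anti _ pi r r' ltac:(lia); lia.
move: rc; rewrite e /region_len gtn_eqF // flat ltnn rlr; lia.
Qed.

Lemma n_label_between r l : 0 < rl r -> 0 < r -> Lam r.+1 < l < Lam r -> ~~ n_label l.
Proof.
move=> rlr r0 l_r; apply/n_labelP => -[r' _ l_r'].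
by have [/(@row_label_anti _ pi)|/(@row_label_anti _ pi)] := leqP r' r; lia.
Qed.

Definition label_type l := (e_label l, n_label l).

(** The types of the labels after [Lam r.+1] up to [Lam r]: pure E labels closed by a corner label
    if the partition drops after row [r], and one pure N label if it does not. *)
Definition type_block r : seq (bool * bool) :=
  if rl r == 0 then [::]
  else if rl r.+1 < rl r then rcons (nseq (rl r - rl r.+1).-1 (true, false)) (true, true)
  else [:: (false, true)].

Fixpoint type_blocks r :=
  if r is r'.+1 then type_block r ++ type_blocks r' else [::].

Lemma type_blockE r : 0 < r -> r < N ->
  [seq label_type l | l <- iota (Lam r.+1).+1 (row_step pi r)] = type_block r.
Proof.
move=> r0 r_N; have LamS := row_labelS pi r_N.
have anti := row_len_anti pi_dom r0 (leqnSn r).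
rewrite /type_block; move: LamS; rewrite /row_step gtn_eqF //.
case: (posnP (rl r)) => [_ _|rlr] //.
case: ltnP => [lt_rl|le_rl] LamS; last first.
  have flat : rl r.+1 = rl r by lia.
  have step1 : maxn (rl r - rl r.+1) 1 = 1 by lia.
  rewrite step1 /=; rewrite step1 add1n in LamS; rewrite /label_type -LamS.
  rewrite (negPf (flat_label r0 rlr flat)); congr [:: (_, _)].
  by apply/n_labelP; exists r => //; rewrite region_len_gt0 // rlr.
have step : maxn (rl r - rl r.+1) 1 = (rl r - rl r.+1).-1.+1 by lia.
rewrite step -[X in iota _ X]addn1 iotaD map_cat -cats1; congr (_ ++ _).
  apply: (@eq_from_nth _ (false, false)); first by rewrite size_map size_iota size_nseq.
  move=> i; rewrite size_map size_iota => lt_i.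
  rewrite (nth_map 0) ?size_iota // nth_iota // nth_nseq lt_i /label_type.
  congr (_, _).
    apply/e_labelP; exists r, (rl r.+1 + i.+1); split; last by lia.
    rewrite /region_len /= gtn_eqF // lt_rl; do ?case: ifP; lia.
  by apply/negbTE; apply: n_label_between rlr r0 _; lia.
have -> : (Lam r.+1).+1 + (rl r - rl r.+1).-1 = Lam r by lia.
by rewrite /= /label_type; have /andP[-> ->] := corner_label r0 lt_rl.
Qed.

Lemma type_blocksE r : r < N ->
  [seq label_type l | l <- iota (Lam r.+1).+1 (Lam 1 - Lam r.+1)] = type_blocks r.
Proof.
elim: r => [_|r IH lt_r]; first by rewrite subnn.
have LamS := row_labelS pi lt_r; have := @row_label_anti _ pi 1 r.+1 isT.
move=> anti; have -> : Lam 1 - Lam r.+2 = row_step pi r.+1 + (Lam 1 - Lam r.+1) by lia.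
rewrite iotaD map_cat type_blockE //= -IH ?(ltnW lt_r) //.
by have -> : (Lam r.+2).+1 + row_step pi r.+1 = (Lam r.+1).+1 by lia.
Qed.

Lemma row_label0 : Lam 0 = (Lam 1).+1.
Proof. by rewrite row_labelS. Qed.

Lemma typesE : [seq label_type l | l <- iota 1 (Lam 0)] =
  (true, false) :: rcons (type_blocks n) (false, true).
Proof.
have LamN : Lam N = 1 by rewrite row_label_end // row_len_gt.
have -> : Lam 0 = 1 + ((Lam 1 - 1) + 1).
  by rewrite row_label0; have := row_label_anti pi (isT : 1 <= N); lia.
rewrite iotaD iotaD !map_cat -[X in X ++ _]/[:: label_type 1] cat1s.
have := type_blocksE (ltnSn n); rewrite LamN => ->.
rewrite -cats1; congr (_ :: _ ++ [:: _]).
  rewrite /label_type; congr (_, _).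
    (* Label 1 belongs to the E step below the first box of the last nonempty row of the diagram. *)
    have [r [rlr rl0]] : exists r, 0 < rl r.+1 /\ rl r.+2 = 0.
      have : exists r, rl r.+2 == 0 by exists n; rewrite row_len_gt //; lia.
      move=> ex; exists (ex_minn ex); case: ex_minnP => -[|r] /eqP r0 rmin //.
      by split=> //; rewrite lt0n; apply/negP => /rmin; rewrite ltnn.
    apply/e_labelP; exists r.+1, 0; rewrite rl0 row_label_end // /region_len /= rl0 ltn0 ltnn.
    by rewrite rlr.
  apply/negbTE/n_labelP => -[r r0] l1.
  have := region_len_row r0; move: r0 l1; case: r => [|r] r0 l1 lt_r.
    by move: l1; rewrite row_label0.
  have rlr : 0 < rl r.+1 by move: r0; rewrite region_len_gt0 // orbF.
  move: l1; rewrite row_labelS // /row_step rlr /=.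
  have : 0 < Lam r.+2 by [].
  lia.
have L1 : 1 <= Lam 1 by [].
have -> : 1 + 1 + (Lam 1 - 1) = Lam 0 by rewrite row_label0; lia.
rewrite /label_type; congr (_, _).
  apply/negbTE/e_labelP => -[r [c [/e_label_bound bd l0]]].
  by have := row_label_anti pi (leq0n r); lia.
by apply/n_labelP; exists 0.
Qed.

Lemma tree_sizeE : tree_size pi = Lam 0.
Proof.
rewrite /tree_size labelsE // big_map; apply/eqP; rewrite eqn_leq; apply/andP; split.
  apply/bigmax_leqP_seq => s sb _ /=; rewrite /nat_label /=.
  have := mem_boundary pi_dom s; rewrite sb /isN; case: ifP => _ e.
    exact: row_label_anti.
  have /andP[_ /ltnW lt] := e_label_bound (esym e).
  exact: leq_trans lt (row_label_anti _ _).
have /n_labelP/hasP[s sb /andP[_ /eqP]] : exists2 r, 0 < rho r & Lam 0 = Lam r by exists 0.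
rewrite labelE // => <-.
by apply: (leq_bigmax_seq (F := nat_label pi \o @nat_step n)).
Qed.

Lemma row_drop r d c : c < rl r.+1 -> rl (r.+1 + d) <= c ->
  exists a, [/\ r < a <= r + d, c < rl a & rl a.+1 <= c].
Proof.
move=> c_r; elim: d => [|d IH]; first by rewrite addn0; lia.
rewrite addnS => le_c; case: (leqP (rl (r.+1 + d)) c) => [/IH[a [? ? ?]]|lt_c].
  by exists a; split=> //; lia.
by exists (r.+1 + d); split=> //; lia.
Qed.

(* The box (0, c) is an elbow of the bottom dream in every column [c]. *)
Lemma tree_edge (i j : 'I_(tree_size pi)) : i < j -> e_label i.+1 -> n_label j.+1 ->
    (forall k : 'I_(tree_size pi), i < k < j -> ~~ (e_label k.+1 && n_label k.+1)) ->
  tree pi i j.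
Proof.
move=> lt_ij /hasP[s sb /andP[Es /eqP ls]] /hasP[s' sb' /andP[Ns' /eqP ls']] no_corner.
rewrite /tree lt_ij; apply/existsP; exists (s'.2.1, s.2.2); apply/andP; split; last first.
  by apply/andP; split; apply/hasP; [exists s|exists s'] => //; rewrite ?ls ?ls' ?Es ?Ns' !eqxx.
move: (ls) (ls'); rewrite !labelE // /nat_label /= -/(isN s) -/(isN s') (negPf Es) Ns'.
move: (sb) (sb'); rewrite !mem_boundary // (negPf Es) Ns' => sbE /eqP sbN li lj.
set b := s.2.1 in sbE li *; set c := s.2.2 in sbE li *; set r := s'.2.1 in sbN lj *.
have bd := e_label_bound sbE.
have le_rb : r <= b by rewrite leqNgt; apply/negP => /(@row_label_anti _ pi); lia.
have c_r : c < rho r by have := region_len_gt_ge le_rb; lia.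
have rl_c : rl r.+1 <= c.
  (* Otherwise some row [a] with [r < a <= b] is the last one to reach beyond column [c]. Its corner
     label [Lam a] would lie strictly between the two given labels. *)
  rewrite leqNgt; apply/negP => lt_c.
  have [|a [/andP[ra ab] lt_a le_a]] := @row_drop r (b - r) c lt_c.
    have -> : r.+1 + (b - r) = b.+1 by lia.
    by have := row_len_region b; lia.
  have La := row_label_anti pi (_ : a <= b); have {}La := La ltac:(lia).
  have Lr : Lam a < Lam r by apply: row_label_lt => //; lia.
  have k_m : (Lam a).-1 < tree_size pi by have := ltn_ord j; lia.
  have [k kE] : exists k : 'I_(tree_size pi), k.+1 = Lam a by exists (Ordinal k_m).
  by have := no_corner k; rewrite kE corner_label; lia.
rewrite inE mem_region //= c_r /=.
(* All boxes below [(r, c)] in the column are elbows, and [(0, c)] is an elbow not among them, so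
   after dropping there are enough dots to fill [(r, c)]. *)
apply: proper_card; apply/properP; split.
  apply/fintype.subsetP => p; rewrite inE => /and3P[pR pc lt_p]; rewrite inE pR pc /=.
  rewrite mem_bottom // -leqNgt (eqP pc).
  by apply: leq_trans rl_c; apply: row_len_anti.
exists (ord0, c); rewrite inE /= ?ltn0 ?andbF //.
rewrite mem_region //= mem_bottom //= row_len0 // eqxx ltn0 andbT.
by apply: leq_trans c_r _; apply: region_len_gt_ge.
Qed.

Lemma tree_types (i j : 'I_(tree_size pi)) : tree pi i j -> e_label i.+1 && n_label j.+1.
Proof.
case/andP=> _ /existsP[p /and3P[_ /hasP[s sb /and3P[Es _ ls]] /hasP[s' sb' /and3P[Ns' _ ls']]]].
by apply/andP; split; apply/hasP; [exists s|exists s'] => //; apply/andP.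
Qed.
End Types.

(** * The cone of the tree and multiplication by powers of 1 - beta *)

Local Open Scope ring_scope.

Section Cone.
Variables (R : realType) (m : nat) (e : rel 'I_m).

Lemma root_cone_edge (i j : 'I_m) : (i < j)%N -> e i j -> root_cone e (root_vector R i j).
Proof.
move=> ij eij; exists (fun a b => ((a == i) && (b == j))%:R); split=> //.
rewrite (bigD1 i) //= (bigD1 j) /=; last by rewrite ij.
rewrite !eqxx scale1r !big1 ?addr0 //.
  by move=> a /negPf ai; rewrite big1 // => b _; rewrite ai scale0r.
by move=> b /andP[_ /negPf bj]; rewrite bj andbF scale0r.
Qed.

Lemma root_coneD (x y : 'rV[R]_m) : root_cone e x -> root_cone e y -> root_cone e (x + y).
Proof.
move=> [w [w0 ->]] [w' [w'0 ->]]; exists (fun a b => w a b + w' a b); split.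
  by move=> a b; apply: addr_ge0.
rewrite -big_split; apply: eq_bigr => a _; rewrite -big_split; apply: eq_bigr => b _.
by rewrite scalerDl.
Qed.

(** A corner label [k] between [i] and [j] ends a first root and starts a second one, since e_i -
    e_j = (e_i - e_k) + (e_k - e_j). Without such a [k] the pair is an edge. *)
Lemma root_cone_paths (Et Nt : pred 'I_m) :
    (forall i j : 'I_m, (i < j)%N -> Et i -> Nt j ->
      (forall k : 'I_m, (i < k < j)%N -> ~~ (Et k && Nt k)) -> e i j) ->
  forall i j : 'I_m, (i < j)%N -> Et i -> Nt j -> root_cone e (root_vector R i j).
Proof.
move=> edge i j; move: {2}(j - i)%N (leqnn (j - i)) => d.
elim: d i j => [|d IH] i j le_d lt_ij Ei Nj; first by lia.
case: (pickP (fun k : 'I_m => (i < k < j)%N && (Et k && Nt k))) => [k|no].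
  case/andP=> /andP[ik kj] /andP[Ek Nk].
  have -> : root_vector R i j = root_vector R i k + root_vector R k j.
    by rewrite /root_vector addrA subrK.
  by apply: root_coneD; apply: IH => //; lia.
apply: root_cone_edge => //; apply: edge => // k ikj.
by have := no k; rewrite ikj /= => ->.
Qed.

Lemma affine_dim_types (Et Nt : pred 'I_m) : (0 < m)%N ->
    (forall i j : 'I_m, (i < j)%N -> Et i -> Nt j -> root_cone e (root_vector R i j)) ->
    (forall l, Et l || Nt l) ->
    (forall l : 'I_m, l = 0 :> nat -> (1 < m)%N -> Et l) ->
    (forall l : 'I_m, l.+1 = m -> Nt l) ->
  (affine_dim (root_polytope R e)).+1 = m.
Proof.
case: m e Et Nt => // m' e' Et Nt _ paths some fst lst; congr _.+1.
apply: (@affine_dimE R m' e' Et Nt) => //.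
- by move=> m'0; apply: fst.
- exact: lst.
Qed.
End Cone.

Lemma series_mul_diff (f : nat -> int) m k :
  series_mul f (fun s => ((1 - 'X : {poly int}) ^+ m)`_s) k = iter m diff f k.
Proof.
elim: m k => [|m IH] k.
  rewrite /series_mul big_ord_recr /= subnn expr0 coef1 eqxx mulr1 big1 ?add0r // => s _.
  by rewrite coef1 subn_eq0 leqNgt ltn_ord mulr0.
rewrite [RHS]/= /diff -IH /series_mul exprS.
under eq_bigr => s _ do rewrite mulrBl mul1r coefB coefXM mulrBr.
rewrite sumrB; congr (_ - _); case: k => [|k].
  by rewrite big_ord1 subnn eqxx mulr0.
rewrite big_ord_recr /= subnn eqxx mulr0 addr0 -IH; apply: eq_bigr => s _.
by rewrite subn_eq0 leqNgt ltn_ord /= subSn ?leq_ord.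
Qed.

(** * The word of the tree against the word of the code *)

Section Words.
Variables (n : nat) (pi : 'S_n.+1).
Hypothesis pi_dom : one_dominant pi.
Local Notation N := n.+1.
Local Notation rl := (row_len pi).

(** A corner letter acts as an increase followed by a decrease, so a block of the tree is a run of
    [rl r - rl r.+1] increases followed by a decrease letter, as in [code_word]. The latter also has
    decrease letters for empty rows; they are met with [z = 0], where they act trivially. *)
Lemma word_poly_blocks (A : comNzRingType) (b : A) :
  word_poly b (type_blocks pi n) 0 = word_poly b (code_word N (ecode pi^-1%g) n) 0.
Proof.
have key r z : (r <= n)%N -> ((0 < r)%N -> rl r = 0%N -> z = 0%N) ->
    word_poly b (type_blocks pi r) z =
    word_poly b (nseq (rl r - rl r.+1) (true, false) ++ code_word N (ecode pi^-1%g) r) z.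
  elim: r z => [|r IH] z le_r z0; first by rewrite word_poly_up.
  set w := nseq (code_mult N (ecode pi^-1%g) r) (true, false) ++ code_word N (ecode pi^-1%g) r.
  have IH' y : (0 < rl r.+1)%N || (y == 0%N) -> word_poly b (type_blocks pi r) y = word_poly b w y.
    move=> ry; rewrite IH ?(ltnW le_r) //; last first.
      move=> r0 rl0; move: ry; have := sorted_row_len pi_dom r0; rewrite rl0 leqn0 => /eqP->.
      by move=> /eqP.
    rewrite /w; case: (posnP r) => [->|r0]; first by rewrite !word_poly_up.
    by rewrite [in LHS](row_lenS pi_dom r0) addKn.
  have wE z' : word_poly b ((false, true) :: w) z' =
      word_poly b w z' + b * \sum_(y < z') word_poly b w y by [].
  rewrite [type_blocks _ _]/= [code_word _ _ _]/= -/w /type_block word_poly_up wE.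
  have [rl0|rl_gt0] := posnP (rl r.+1).
    rewrite z0 // rl0 /= big_ord0 mulr0 addr0; by rewrite IH' ?orbT.
  have IHs y : word_poly b (type_blocks pi r) y = word_poly b w y by rewrite IH' ?rl_gt0.
  case: ltnP => [lt_rl|le_rl].
    rewrite -cats1 -catA word_poly_up /=.
    have -> : (1 + ((rl r.+1 - rl r.+2).-1 + z) = rl r.+1 - rl r.+2 + z)%N by lia.
    by rewrite IHs; under eq_bigr do rewrite IHs.
  have -> : (rl r.+1 - rl r.+2 = 0)%N by lia.
  by rewrite /= !add0n IHs; under eq_bigr do rewrite IHs.
rewrite key //.
by rewrite (row_len_gt _ (leqnn n)).
Qed.

Lemma type_blocks_some r : all (fun l => l.1 || l.2) (type_blocks pi r).
Proof.
elim: r => //= r IH; rewrite all_cat IH andbT /type_block.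
by do ?case: ifP => //; rewrite all_rcons /= all_nseq orbT.
Qed.

(** For the identity the region is a single box, which is not a cross of the bottom dream. Its E
    step is unlabelled, and the only vertex comes from the N step. *)
Lemma labels_trivial : rl 1 = 0%N -> exists s1 s2 : step N,
  [/\ boundary pi = [:: s1; s2], labels pi = [:: 0; 1]%N, ~~ isN s1 & isN s2].
Proof.
move=> rl1; have rl0 a : (0 < a)%N -> rl a = 0%N.
  by move=> a0; apply/eqP; rewrite -leqn0 -rl1 row_len_anti.
have rho0 a : (0 < a)%N -> region_len pi a = 0%N.
  by move=> a0; rewrite /region_len gtn_eqF // !rl0.
have : map (@nat_step n) (boundary pi) = [:: (false, (0, 0)); (true, (0, 0))]%N.
  rewrite boundary_rows // -cat1s (_ : iota 0 N = [:: 0] ++ iota 1 n)%N //.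
  rewrite rev_cat map_cat flatten_cat.
  rewrite (_ : flatten _ = [::]); last first.
    apply/nilP; rewrite /nilp size_flatten sumnE !big_map big_seq big1 // => a.
    rewrite mem_rev mem_iota => /andP[a0 _].
    by rewrite /boundary_row !rho0.
  by rewrite /= /boundary_row rho0 // /region_len /= rl1.
case bE: (boundary pi) => [|s1 [|s2 [|]]] //= [N1 r1 c1 N2 r2 c2].
exists s1, s2; rewrite /isN N1 N2; split=> //.
rewrite /labels bE /= /in_A /bounds /isN !mem_bottom // N1 N2 r1 (row_len0 pi_dom) ltn0 /=.
by [].
Qed.

Lemma tree_typesE :
  [seq label_type pi l | l <- iota 1 (tree_size pi)] =
  if (0 < rl 1)%N then (true, false) :: rcons (type_blocks pi n) (false, true)
  else [:: (false, true)].
Proof.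
case: posnP => [rl1|rl1]; last by rewrite tree_sizeE // typesE.
have [s1 [s2 [bE lE N1 N2]]] := labels_trivial rl1.
have s12 : (s1 == s2) = false by apply: contraNF N1 => /eqP ->.
rewrite /tree_size lE !big_cons big_nil /= /label_type /e_label /n_label bE /label lE bE /=.
by rewrite !eqxx s12 N2 (negPf N1).
Qed.

Lemma tree_size_gt0 : (0 < tree_size pi)%N.
Proof.
rewrite -(size_iota 1 (tree_size pi)) -(size_map (label_type pi)) tree_typesE.
by case: ifP.
Qed.

Lemma nth_type (i : 'I_(tree_size pi)) :
  label_type pi i.+1 = nth (false, false) [seq label_type pi l | l <- iota 1 (tree_size pi)] i.
Proof. by rewrite (nth_map 0%N) ?size_iota // nth_iota. Qed.

Lemma tree_paths (R : realType) (i j : 'I_(tree_size pi)) :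
  (i < j)%N -> e_label pi i.+1 -> n_label pi j.+1 -> root_cone (tree pi) (root_vector R i j).
Proof.
have [rl1|rl1] := posnP (rl 1); last first.
  apply: (@root_cone_paths R _ _ (fun i => e_label pi i.+1) (fun i => n_label pi i.+1)).
  exact: tree_edge.
have := ltn_ord j; rewrite -{2}(size_iota 1 (tree_size pi)) -(size_map (label_type pi)).
rewrite tree_typesE rl1.
by rewrite /= ltnS leqn0 => /eqP->.
Qed.
End Words.

Theorem theorem6p4 (R : realType) (n : nat) (pi : 'S_n.+1)
    (hpi : one_dominant pi) :
  let P := root_polytope R (tree pi) in
  forall k : nat,
    (grothendieck pi ('X - 1 : {poly int}) (fun=> 1))`_k =
    series_mul (fun s => (ehrhart P s)%:Z)
               (fun s => ((1 - 'X : {poly int}) ^+ (affine_dim P).+1)`_s) k.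
Proof.
move=> P k.
pose Et (i : 'I_(tree_size pi)) := e_label pi i.+1.
pose Nt (i : 'I_(tree_size pi)) := n_label pi i.+1.
have paths := @tree_paths _ _ hpi R.
have typesE : [seq (Et i, Nt i) | i <- enum 'I_(tree_size pi)] =
    [seq label_type pi l | l <- iota 1 (tree_size pi)].
  by rewrite (iotaDl 1 0) -val_enum_ord -!map_comp.
have types := tree_typesE hpi.
have dimP : (affine_dim P).+1 = tree_size pi.
  apply: (@affine_dim_types R _ _ Et Nt) => //; first exact: tree_size_gt0.
  - move=> l; have : all (fun t => t.1 || t.2) [seq label_type pi l | l <- iota 1 (tree_size pi)].
      by rewrite types; case: ifP => //= _; rewrite all_rcons type_blocks_some.
    move=> /allP some; apply: (some (label_type pi l.+1)); apply: map_f.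
    by rewrite mem_iota /= add1n ltnS.
  - move=> l l0 m1; suff : (label_type pi l.+1).1 by [].
    rewrite nth_type; move: m1.
    rewrite -{1}(size_iota 1 (tree_size pi)) -(size_map (label_type pi)) types l0.
    by case: ifP.
  move=> l lm; suff : (label_type pi l.+1).2 by [].
  have sz : size [seq label_type pi l | l <- iota 1 (tree_size pi)] = l.+1.
    by rewrite size_map size_iota.
  rewrite nth_type -[nat_of_ord l]/l.+1.-1 -sz nth_last types.
  by case: ifP => //= _; rewrite last_rcons.
rewrite (grothendieck_dominant _ hpi) addrC subrK -word_poly_blocks // dimP.
have ehrE s : ehrhart P s = lattice_count [seq (Et i, Nt i) | i <- enum 'I_(tree_size pi)] 0 s.
  by apply: ehrhartE => // i j _; apply: tree_types.
under [in RHS]eq_fun => s do rewrite ehrE typesE types.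
rewrite series_mul_diff.
have -> : tree_size pi = size (if (0 < row_len pi 1)%N
    then (true, false) :: rcons (type_blocks pi n) (false, true) else [:: (false, true)]).
  by rewrite -types size_map size_iota.
case: posnP => [rl1|rl1].
  (* For the identity the polytope is a point, with Ehrhart series 1 / (1 - beta), and both sides
     are 1. *)
  have -> : forall r, type_blocks pi r = [::].
    elim=> //= r ->; rewrite /type_block cats0.
    by have := row_len_anti hpi (isT : 0 < 1)%N (isT : 1 <= r.+1)%N; rewrite rl1 leqn0 => ->.
  rewrite coef1; transitivity (diff (countZ [:: (false, true)] 0%N) k); last by [].
  by rewrite /diff /shift; case: (k) => [|k']; rewrite !count_down1.
(* The leading pure E label is the single [up] that encodes [z = 0], and the number of labels is the
   exponent in [count_word_poly]. *)
rewrite -cats1 [size _]/= size_cat.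
rewrite -(count_word_poly 0 k (type_blocks_some pi n)) add1n addn1.
by rewrite [iter 1 _ _]/= -countZ_up.
Qed.
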